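(* Let $(\mathcal X,\mathcal F,\nu)$ be a probability space equipped with an atomic filtration (as described in the context), and let $w$ be a weight on $\mathcal X$ with $[w]_{2,\mathcal D}<\infty$. Then for every $f\in L^2(w)$ with $\int_{\mathcal X} f\,d\nu=0$, $$\|f\|_{L^2(w)}\le C\,[w]_{2,\mathcal D}^{1/2}[w]_{\infty,\mathcal D}^{1/2}\,\|Sf\|_{L^2(w)}\le 2C\,[w]_{2,\mathcal D}\,\|Sf\|_{L^2(w)},$$ where $C$ is an absolute constant (independent of $f$, $w$, $\nu$ and the filtration).
   Context: Atomic filtration: $\mathcal F_0\subset\mathcal F_1\subset\cdots$ is an increasing sequence of $\sigma$-algebras generating $\mathcal F$, with $\mathcal F_0=\{\emptyset,\mathcal X\}$, and each $\mathcal F_n$ is generated by a finite partition $\mathcal D_n$ of $\mathcal X$ into sets of positive measure (atoms); $\mathcal D_0=\{\mathcal X\}$. An atom is formally a pair $(I,n)$ with $I\in\mathcal D_n$ (a set may be an atom of several generations); $\mathcal D=\bigcup_n\mathcal D_n$ denotes all atoms, $|I|=\nu(I)$, and the children $\mathrm{ch}(I)$ of $(I,n)$ are the atoms of $\mathcal D_{n+1}$ contained in $I$. For an atom $J$, $\mathcal D(J)$ denotes the atoms $(I,m)$ with $I\subset J$ and $m\ge$ the generation of $J$. Averages: $\langle f\rangle_I=|I|^{-1}\int_I f\,d\nu$, $\mathbb E_I f=\langle f\rangle_I\mathbf 1_I$. Martingale differences: $\Delta_I f=\sum_{I'\in\mathrm{ch}(I)}\mathbb E_{I'}f-\mathbb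 E_I f$. Square function: $Sf=\big(\sum_{I\in\mathcal D}(\Delta_I f)^2\big)^{1/2}$. A weight is an integrable function $w>0$ $\nu$-a.e.; $\|f\|_{L^2(w)}^2=\int|f|^2w\,d\nu$. Martingale $A_2$ characteristic: $[w]_{2,\mathcal D}=\sup_{I\in\mathcal D}\langle w\rangle_I\langle w^{-1}\rangle_I$. Martingale localized maximal function: $M_I^{\mathcal D}f(x)=\mathbf 1_I(x)\sup_{J\in\mathcal D(I),\,x\in J}|\langle f\rangle_J|$; martingale $A_\infty$ characteristic: $[w]_{\infty,\mathcal D}=\sup_{I\in\mathcal D}\langle M_I^{\mathcal D}w\rangle_I/\langle w\rangle_I$. *)

(* Defs.v *)
From HB Require Import structures.
From mathcomp Require Import all_boot all_order all_algebra.
From mathcomp Require Import all_classical all_reals all_analysis.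
Set Implicit Arguments. Unset Strict Implicit. Unset Printing Implicit Defensive.
Import Order.TTheory GRing.Theory Num.Theory.
Local Open Scope classical_set_scope.
Local Open Scope ring_scope.
Local Open Scope ereal_scope.

Section Defs.
Context {d : measure_display} {T : measurableType d} {R : realType}.
Variable mu : {measure set T -> \bar R}.

(* An atomic filtration: D n is the finite partition D_n generating F_n. *)
Definition atomic_filtration (D : nat -> set (set T)) : Prop :=
  D 0%N = [set setT] /\
  (forall n, finite_set (D n)) /\
  (forall n I, D n I -> measurable I /\ 0 < mu I) /\
  (forall n, \bigcup_(I in D n) I = setT) /\
  (forall n I J, D n I -> D n J -> I <> J -> I `&` J = set0) /\
  (forall n J, D n.+1 J -> exists I, D n I /\ J `<=` I) /\
  (* F is generated by the F_n (equivalently by all atoms) *)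
  @measurable d T = <<s [set A | exists n, D n A] >>.

Definition eavg (I : set T) (g : T -> \bar R) : \bar R :=
  ((fine (mu I))^-1)%:E * \int[mu]_(x in I) g x.

Definition avg (I : set T) (f : T -> R) : R := fine (eavg I (EFin \o f)).

Definition condE (I : set T) (f : T -> R) (x : T) : R :=
  (avg I f * \1_I x)%R.

Definition mdiff (D : nat -> set (set T)) (n : nat) (I : set T)
    (f : T -> R) (x : T) : R :=
  ((\sum_(J \in [set J | D n.+1 J /\ J `<=` I]) condE J f x) - condE I f x)%R.

Definition sqfun (D : nat -> set (set T)) (f : T -> R) (x : T) : \bar R :=
  sqrte (\sum_(n <oo) (\sum_(I \in D n) ((mdiff D n I f x) ^+ 2)%:E)).

Definition L2w (w : T -> R) (g : T -> \bar R) : \bar R :=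
  sqrte (\int[mu]_x ((`|g x|) ^+ 2 * (w x)%:E)).

Definition A2 (D : nat -> set (set T)) (w : T -> R) : \bar R :=
  ereal_sup [set r | exists n I, D n I /\
     r = eavg I (EFin \o w) * eavg I (fun x => ((w x)^-1)%:E)].

Definition Mloc (D : nat -> set (set T)) (n : nat) (I : set T)
    (w : T -> R) (x : T) : \bar R :=
  (\1_I x)%:E *
  ereal_sup [set r | exists m J, [/\ (n <= m)%N, D m J, J `<=` I & J x] /\
     r = `|eavg J (EFin \o w)|].

Definition Ainf (D : nat -> set (set T)) (w : T -> R) : \bar R :=
  ereal_sup [set r | exists n I, D n I /\
     r = eavg I (Mloc D n I w) * ((fine (eavg I (EFin \o w)))^-1)%:E].

End Defs.

(* Main.v *)
Require Import Defs.
From HB Require Import structures.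
From mathcomp Require Import all_boot all_order all_algebra.
From mathcomp Require Import all_classical all_reals all_analysis.
From mathcomp Require Import measurable_realfun finmap ring lra.
Set Implicit Arguments. Unset Strict Implicit. Unset Printing Implicit Defensive.
Import Order.TTheory GRing.Theory Num.Theory.
Local Open Scope classical_set_scope.
Local Open Scope ring_scope.

(** Write [m, W, S, F] for the integrals of [1, w, 1/w, f] over an atom and
    [f_n] for the conditional expectation of [f] on the [n]-th generation.
    Pairing [f_n] with [f_n w] and expanding both in martingale differences,
    AM-GM bounds [||f_n||^2] in [L^2(w)] by [||Sf||^2] plus a dual sum; the
    latter splits into a telescoping sum and a Carleson embedding sum with
    weights [b_I = <w>_I^2 (\sum_(I' child of I) V I' - V I)], [V = m^2/W].
    As [V] is subadditive over children and [V <= S], the sum of [b] over the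
    descendants of [I], when [<w>] is replaced by its running maximum and one
    sums by parts, is at most [2 [w]_2] times the integral of the maximal
    function, i.e. [2 [w]_2 [w]_oo W I].  The limit in [n] uses only that
    [f_n -> f] in [L^1], which follows from density of step functions.
    The second inequality is [[w]_oo <= 2 [w]_2], a form of Doob's maximal
    inequality for the measure [dnu/w]. *)

(** * Finite trees *)

Section FiniteTree.
Context {R : realFieldType} {A : eqType}.
Variables (ch : A -> seq A) (P : A -> Prop).

Fixpoint leafsum (g : A -> R) k I :=
  if k is k'.+1 then \sum_(J <- ch I) leafsum g k' J else g I.

(** Only depths below [k] are counted: the quantities summed look at the children of a node, so
    depth [k] is reached exactly, as in [leafsum]. *)
Fixpoint nodesum (b : A -> R) k I :=
  if k is k'.+1 then b I + \sum_(J <- ch I) nodesum b k' J else 0.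

(* With [m] the measure and [w] the averages of a weight, this is the integral
   over [I] of the maximum of [l] and the averages over the descendants of [I]
   at depth at most [k]; [I] itself is left out. *)
Fixpoint maxsum (m w : A -> R) k l I :=
  if k is k'.+1 then \sum_(J <- ch I) maxsum m w k' (Num.max l (w J)) J
  else l * m I.

Definition tree_additive (g : A -> R) :=
  forall I, P I -> g I = \sum_(J <- ch I) g J.

Hypothesis P_ch : forall I J, P I -> J \in ch I -> P J.

Lemma ler_sum_ch (I : A) (g h : A -> R) : P I ->
  (forall J, P J -> J \in ch I -> g J <= h J) ->
  \sum_(J <- ch I) g J <= \sum_(J <- ch I) h J.
Proof.
move=> PI gh; rewrite big_seq [leRHS]big_seq; apply: ler_sum => J JI.
by apply: gh => //; exact: P_ch JI.
Qed.

Lemma leafsum_additive g k I : tree_additive g -> P I -> leafsum g k I = g I.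
Proof.
move=> ag; elim: k I => //= k IH I PI; rewrite (ag I PI).
by apply: eq_big_seq => J JI; apply/IH/(P_ch PI JI).
Qed.

Lemma ler_leafsum g h k I : (forall J, P J -> g J <= h J) -> P I ->
  leafsum g k I <= leafsum h k I.
Proof.
move=> gh; elim: k I => [|k IH] I PI /=; first exact: gh.
by apply: ler_sum_ch => // J PJ _; exact: IH.
Qed.

(** * Running maxima and the Carleson condition on a finite tree *)

Variables (m W S : A -> R) (Q : R).
Hypotheses (m_add : tree_additive m) (W_add : tree_additive W).
Hypothesis S_add : tree_additive S.
Hypothesis m_gt0 : forall I, P I -> 0 < m I.
Hypothesis W_gt0 : forall I, P I -> 0 < W I.
Hypothesis S_gt0 : forall I, P I -> 0 < S I.
Hypothesis CS : forall I, P I -> m I ^+ 2 <= W I * S I.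
Hypothesis A2Q : forall I, P I -> W I * S I <= Q * m I ^+ 2.

Let w I := W I / m I.
Let V I := m I ^+ 2 / W I.
Let b I := w I ^+ 2 * (\sum_(J <- ch I) V J - V I).

Lemma node_const_ge1 I : P I -> 1 <= Q.
Proof.
move=> PI; have m2 : 0 < m I ^+ 2 by rewrite exprn_gt0// m_gt0.
by rewrite -(ler_pM2r m2) mul1r (le_trans (CS PI))// A2Q.
Qed.

(* With [x = m/S], the averages satisfy [w <= Q x], and [l^2/2 - l x] is a
   supermartingale (for the measure [S]) along [l := max l x]; this is Doob's
   inequality in pathwise form, scaled by [Q]. *)
Lemma maxsum_le_A2 k l I : P I ->
  maxsum m w k l I <= 2 * Q * W I + l ^+ 2 * S I / (2 * Q) - l * m I.
Proof.
elim: k l I => [|k IH] l I PI /=.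
  have Q0 : 0 < Q by rewrite (lt_le_trans ltr01)// (node_const_ge1 PI).
  have S0 := S_gt0 PI; have cs := CS PI.
  (* At a leaf the excess over [l * m I] is a Cauchy-Schwarz defect plus a complete square. *)
  have e : 2 * Q * W I + l ^+ 2 * S I / (2 * Q) - l * m I - l * m I =
    (2 * Q * (W I * S I - m I ^+ 2) + (l * S I - 2 * Q * m I) ^+ 2 / (2 * Q))
      / S I.
    by field; rewrite !gt_eqF.
  rewrite -subr_ge0 e divr_ge0 ?(ltW S0)// addr_ge0//.
    by rewrite mulr_ge0 ?subr_ge0// mulr_ge0// ltW.
  by rewrite divr_ge0 ?sqr_ge0// mulr_ge0// ltW.
have Q0 : 0 < Q by rewrite (lt_le_trans ltr01)// (node_const_ge1 PI).
apply: (@le_trans _ _ (\sum_(J <- ch I)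
    (2 * Q * W J + l ^+ 2 / (2 * Q) * S J - l * m J))).
  apply: ler_sum_ch => // J PJ _; apply: (le_trans (IH _ _ PJ)).
  have mJ := m_gt0 PJ; have SJ := S_gt0 PJ; have aJ := A2Q PJ.
  case: (leP (w J) l) => lw; first by rewrite (mulrAC (l ^+ 2)).
  (* The parabola [c ^+ 2 * S J / (2 * Q) - c * m J] has its vertex at [Q * m J / S J], which is at
     least [w J]; raising [c] from [l] to [w J] therefore lowers it. *)
  have wS : w J * S J <= Q * m J.
    rewrite -(ler_pM2r mJ) mulrAC divfK ?gt_eqF//.
    by rewrite -mulrA -expr2.
  have lS : (l + w J) * S J <= 2 * (Q * m J).
    apply: (@le_trans _ _ (2 * (w J * S J))); last by rewrite ler_pM2l.
    by rewrite mulrA ler_pM2r//; lra.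
  rewrite -subr_ge0.
  rewrite (_ : _ - _ = (w J - l) * (2 * (Q * m J) - (l + w J) * S J) / (2 * Q)).
    by rewrite divr_ge0 ?mulr_ge0 ?subr_ge0// ltW.
  by field; rewrite gt_eqF.
rewrite sumrB big_split -!mulr_sumr -(W_add PI) -(S_add PI) -(m_add PI) /=.
by rewrite (mulrAC (l ^+ 2)).
Qed.

(** For the initial value [l = w I] the two terms of [maxsum_le_A2] that contain [l] have a
    nonpositive sum, by [A2Q]. *)
Lemma maxsum_w_le_A2 k I : P I -> maxsum m w k (w I) I <= 2 * Q * W I.
Proof.
move=> PI; apply: (le_trans (maxsum_le_A2 _ _ PI)).
have Q0 : 0 < Q by rewrite (lt_le_trans ltr01)// (node_const_ge1 PI).
have mI := m_gt0 PI; have WI := W_gt0 PI; have aI := A2Q PI.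
rewrite -addrA gerDl -[w I ^+ 2 * _ / _]mulrA.
have -> : w I ^+ 2 * (S I / (2 * Q)) - w I * m I
  = W I * (W I * S I - 2 * (Q * m I ^+ 2)) / (2 * Q * m I ^+ 2).
  by rewrite /w; field; rewrite !gt_eqF.
rewrite pmulr_lle0 ?invr_gt0 ?mulr_gt0 ?exprn_gt0// pmulr_rle0// subr_le0.
have : 0 <= Q * m I ^+ 2 by rewrite mulr_ge0 ?sqr_ge0// ltW.
by move: aI; lra.
Qed.

(** The left side is the tangent plane of the convex function [x ^+ 2 / y] along the ray
    [x = c * y]. *)
Lemma sqr_div_tangent (x y c : R) : 0 < y ->
  2 * c * x - c ^+ 2 * y <= x ^+ 2 / y.
Proof.
move=> y0; rewrite -subr_ge0.
rewrite (_ : _ - _ = (x - c * y) ^+ 2 / y); last by field; rewrite gt_eqF.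
by rewrite divr_ge0 ?sqr_ge0// ltW.
Qed.

(** Cauchy-Schwarz in quotient form: the tangent planes at the common ratio [X / Y] add up to
    [X ^+ 2 / Y]. *)
Lemma sum_sqr_div (I : A) (x y : A -> R) : P I ->
  (forall J, P J -> J \in ch I -> 0 < y J) -> 0 < \sum_(J <- ch I) y J ->
  (\sum_(J <- ch I) x J) ^+ 2 / \sum_(J <- ch I) y J
    <= \sum_(J <- ch I) x J ^+ 2 / y J.
Proof.
move=> PI y0 Y0; set X := \sum_(J <- ch I) x J; set Y := \sum_(J <- ch I) y J.
apply: (@le_trans _ _ (\sum_(J <- ch I)
    (2 * (X / Y) * x J - (X / Y) ^+ 2 * y J))).
  rewrite sumrB -!mulr_sumr -/X -/Y.
  rewrite (_ : 2 * (X / Y) * X - (X / Y) ^+ 2 * Y = X ^+ 2 / Y)//.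
  by field; rewrite gt_eqF.
by apply: ler_sum_ch => // J PJ JI; apply: sqr_div_tangent; exact: y0.
Qed.

(** This makes the Carleson weights [b] nonnegative. *)
Lemma V_subadditive I : P I -> V I <= \sum_(J <- ch I) V J.
Proof.
move=> PI; rewrite /V {1}(m_add PI) {1}(W_add PI); apply: sum_sqr_div => //.
  by move=> J PJ _; exact: W_gt0.
by rewrite -(W_add PI) W_gt0.
Qed.

Lemma leafsum_V_le k I : P I -> leafsum V k I <= S I.
Proof.
move=> PI; rewrite -(leafsum_additive k S_add PI); apply: ler_leafsum => // J PJ.
by rewrite ler_pdivrMr ?W_gt0// mulrC CS.
Qed.

(* Summation by parts: [l] increases only when [l = w J], and there
   [l * (leafsum V k J - V J) <= w J * S J <= Q * m J]. *)
Lemma nodesum_le_maxsum k l I : P I -> w I <= l ->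
  nodesum b k I <= l ^+ 2 * (leafsum V k I - V I)
                   + 2 * Q * (maxsum m w k l I - l * m I).
Proof.
elim: k l I => [|k IH] l I PI wl /=; first by rewrite !subrr !mulr0 addr0.
have Q0 : 0 < Q by rewrite (lt_le_trans ltr01)// (node_const_ge1 PI).
have w0 : 0 < w I by rewrite divr_gt0 ?m_gt0 ?W_gt0.
have step : \sum_(J <- ch I) nodesum b k J <= \sum_(J <- ch I)
   (l ^+ 2 * (leafsum V k J - V J)
     + 2 * Q * (maxsum m w k (Num.max l (w J)) J - l * m J)).
  apply: ler_sum_ch => // J PJ _.
  have wJ : w J <= Num.max l (w J) by rewrite le_max lexx orbT.
  apply: (le_trans (IH _ _ PJ wJ)).
  case: (leP (w J) l) => lw //.
  have mJ := m_gt0 PJ; have WJ := W_gt0 PJ; have aJ := A2Q PJ.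
  have VJ : 0 < V J by rewrite divr_gt0 ?exprn_gt0.
  have LS := leafsum_V_le k PJ.
  set r := leafsum V k J - V J; set M := maxsum m w k (w J) J.
  have rS : r <= S J by rewrite /r; lra.
  have w1 : 0 < w J by rewrite divr_gt0.
  have wr : w J * r <= Q * m J.
    apply: (@le_trans _ _ (w J * S J)); first by rewrite ler_pM2l.
    rewrite -(ler_pM2r mJ) mulrAC divfK ?gt_eqF//.
    by rewrite -mulrA -expr2.
  rewrite -subr_ge0.
  have -> : l ^+ 2 * r + 2 * Q * (M - l * m J) -
     (w J ^+ 2 * r + 2 * Q * (M - w J * m J)) =
     (w J - l) * (2 * (Q * m J) - (w J + l) * r) by ring.
  rewrite mulr_ge0 ?subr_ge0 ?(ltW lw)//.
  (* If [r >= 0], then [l < w J] gives [(w J + l) * r <= 2 * (w J * r)]; if [r < 0], the product is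
     negative anyway. *)
  case: (leP 0 r) => r0.
    apply: (@le_trans _ _ (2 * (w J * r))); last by rewrite ler_pM2l.
    by rewrite mulrA ler_wpM2r//; lra.
  apply: (@le_trans _ _ 0).
    by rewrite pmulr_rle0 ?(ltW r0)//; lra.
  by rewrite mulr_ge0// mulr_ge0// ltW.
move: step; rewrite big_split -!mulr_sumr !sumrB -mulr_sumr -(m_add PI) /= => step.
(* The invariant [w I <= l] replaces the factor [w I ^+ 2] by [l ^+ 2], common to [I] and its
   children, so that the increments of [V] telescope. *)
have bI : b I <= l ^+ 2 * (\sum_(J <- ch I) V J - V I).
  rewrite /b ler_wpM2r ?subr_ge0 ?V_subadditive//.
  by rewrite ler_pXn2r// nnegrE ltW// (lt_le_trans w0 wl).
apply: (le_trans (lerD bI step)).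
by rewrite le_eqVlt; apply/orP; left; apply/eqP; ring.
Qed.

Variable Qi : R.
Hypothesis AinfQ : forall k I, P I -> maxsum m w k (w I) I <= Qi * W I.

(** Summation by parts is started at [l = w I]. Its boundary term is at most [Q * W I] and is
    absorbed by [- 2 * Q * W I], which comes from [l * m I = W I]. *)
Lemma nodesum_carleson k I : P I -> nodesum b k I <= 2 * Q * Qi * W I.
Proof.
move=> PI; apply: (le_trans (nodesum_le_maxsum k PI (lexx _))).
have mI := m_gt0 PI; have WI := W_gt0 PI; have aI := A2Q PI.
have Q0 : 0 < Q by rewrite (lt_le_trans ltr01)// (node_const_ge1 PI).
have VI : 0 < V I by rewrite divr_gt0 ?exprn_gt0.
have LS := leafsum_V_le k PI.
have h1 : w I ^+ 2 * (leafsum V k I - V I) <= Q * W I.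
  apply: (@le_trans _ _ (w I ^+ 2 * S I)).
    by rewrite ler_pM2l ?exprn_gt0 ?divr_gt0//; lra.
  rewrite (_ : w I ^+ 2 * S I = W I * (W I * S I) / m I ^+ 2); last first.
    by rewrite /w; field; rewrite gt_eqF.
  by rewrite ler_pdivrMr ?exprn_gt0// (mulrC Q) -mulrA ler_pM2l.
have h2 : 2 * Q * maxsum m w k (w I) I <= 2 * Q * (Qi * W I).
  by rewrite ler_pM2l ?AinfQ// mulr_gt0.
have h3 : 0 < Q * W I by rewrite mulr_gt0.
have -> : w I * m I = W I by rewrite /w divfK ?gt_eqF.
by move: h1 h2 h3; lra.
Qed.

(** * Carleson embedding and the square function on a finite tree *)

Variable F : A -> R.
Hypothesis F_add : tree_additive F.

(** With [F] the integral of a function f, [s I] is the squared weighted norm of its martingale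
    difference at [I], and [G k I], [H k I] are the integrals over [I] of g w and g^2 w, where g
    averages f over the nodes [k] levels below [I]. *)
Let a I := F I / m I.
Let s I := \sum_(J <- ch I) (a J - a I) ^+ 2 * W J.
Let G := leafsum (fun I => a I * W I).
Let H := leafsum (fun I => a I ^+ 2 * W I).

(** On one child the left side is the product of the increments [x = F' / m' - f] and
    [G' - h * v * m' = W' * y + h * z]. AM-GM with parameter [t], then
    [(p + q) ^+ 2 <= 2 * p ^+ 2 + 2 * q ^+ 2], separate the change [y] of the weighted mean from the
    change [z] of the weight. *)
Lemma cross_term_le (t m' W' F' G' f h v : R) : 0 < t -> 0 < m' -> 0 < W' ->
  F' * G' / m' - (h * v) * F' - f * G' + f * (h * v) * m' <=
  t / 2 * ((F' / m' - f) ^+ 2 * W') +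
  t^-1 * (G' ^+ 2 / W' - 2 * h * G' + h ^+ 2 * W' +
          h ^+ 2 * (W' - 2 * v * m' + v ^+ 2 * (m' ^+ 2 / W'))).
Proof.
move=> t0 m0 W0; rewrite -subr_ge0.
set x := F' / m' - f.
set y := G' / W' - h; set z := W' - v * m'.
rewrite (_ : _ - _ = (2 * t * W')^-1 *
   ((t * x * W' - (W' * y + h * z)) ^+ 2 + (W' * y - h * z) ^+ 2)).
  by rewrite mulr_ge0 ?addr_ge0 ?sqr_ge0// invr_ge0 !mulr_ge0// ltW.
by rewrite /x /y /z; field; rewrite !gt_eqF.
Qed.

(* The Bellman function [4 (x - y^2 / (1 + M))] of Carleson embedding,
   in the homogeneous variables [g0 = y W0] and [T = M B W0]. *)
Lemma carleson_step (B W0 T c g0 sg : R) : 0 < B -> 0 < W0 -> 0 <= c ->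
  0 <= T -> c + T <= B * W0 -> g0 ^+ 2 / (B * W0 + T) <= sg ->
  (g0 / W0) ^+ 2 * c - 4 * B * (B * sg)
   <= - (4 * B * (B * (g0 ^+ 2 / (B * W0 + (c + T))))).
Proof.
move=> B0 W00 c0 T0 cT sgle.
have BW : 0 < B * W0 by rewrite mulr_gt0.
have Y1 : 0 < B * W0 + T by rewrite ltr_wpDr.
have Y2 : 0 < B * W0 + (c + T) by rewrite ltr_wpDr// addr_ge0.
apply: (@le_trans _ _
  ((g0 / W0) ^+ 2 * c - 4 * B * (B * (g0 ^+ 2 / (B * W0 + T))))).
  by rewrite lerD2l lerN2 !ler_pM2l ?mulr_gt0.
rewrite -subr_ge0.
rewrite (_ : _ - _ =
   g0 ^+ 2 * c / (W0 ^+ 2 * (B * W0 + T) * (B * W0 + (c + T))) *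
   (4 * (B * W0) ^+ 2 - (B * W0 + T) * (B * W0 + (c + T)))); last first.
  by field; rewrite !gt_eqF.
rewrite mulr_ge0//.
  apply: divr_ge0; first by rewrite mulr_ge0 ?sqr_ge0.
  by apply/mulr_ge0/ltW => //; apply/mulr_ge0/ltW => //; exact: sqr_ge0.
rewrite subr_ge0.
(* By [cT] both denominators are at most [2 * (B * W0)]; this is the source of the constant 4. *)
apply: (@le_trans _ _ ((2 * (B * W0)) * (2 * (B * W0)))).
  by apply: ler_pM; rewrite ?(ltW Y1) ?(ltW Y2)//; lra.
by rewrite le_eqVlt; apply/orP; left; apply/eqP; ring.
Qed.

Lemma nodesum_ge0 k I : P I -> 0 <= nodesum b k I.
Proof.
elim: k I => //= k IH I PI; rewrite addr_ge0//.
  by rewrite mulr_ge0 ?sqr_ge0// subr_ge0 V_subadditive.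
rewrite big_seq; apply: sumr_ge0 => J JI; apply: IH; exact: P_ch JI.
Qed.

(** The form is dictated by induction on depth: [F I * G k I / m I] is the pairing at the root,
    [H k I - G k I ^+ 2 / W I] the telescoped increments of [G ^+ 2 / W], and the last difference
    the Bellman potential that pays for the Carleson sum of [b]. *)
Lemma square_function_potential (t B : R) k I : 0 < t -> 0 < B ->
  (forall k I, P I -> nodesum b k I <= B * W I) -> P I ->
  H k I <= F I * G k I / m I + t / 2 * nodesum s k I +
     t^-1 * ((H k I - G k I ^+ 2 / W I)
       + 4 * B * (H k I - B * (G k I ^+ 2 / (B * W I + nodesum b k I)))).
Proof.
move=> t0 B0 carl; elim: k I => [|k IH] I PI.
  (* At depth 0 one has [G ^+ 2 / W = H] and no node sum, so both differences vanish and equality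
     holds. *)
  rewrite /H /G /= /a; have mI := m_gt0 PI; have WI := W_gt0 PI.
  rewrite le_eqVlt; apply/orP; left; apply/eqP; field.
  by rewrite !gt_eqF//= ?addr0 ?mulr_gt0.
have mI := m_gt0 PI; have WI := W_gt0 PI.
have HE : H k.+1 I = \sum_(J <- ch I) H k J by [].
have GE : G k.+1 I = \sum_(J <- ch I) G k J by [].
set g0 := G k.+1 I in GE *; set h := g0 / W I.
(* For each child the induction hypothesis is combined with [cross_term_le]; the terms linear in
   [F], [G], [m], [W] then sum to values at [I]. *)
have sumH : \sum_(J <- ch I) H k J <= \sum_(J <- ch I) (
   (a I * G k J + h * w I * F J - a I * (h * w I) * m J) +
   t / 2 * ((a J - a I) ^+ 2 * W J) +
   t^-1 * (- (2 * h) * G k J + h ^+ 2 * (2 * W J - 2 * w I * m J) +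
      (h * w I) ^+ 2 * V J) +
   t / 2 * nodesum s k J + t^-1 * (1 + 4 * B) * H k J
   - t^-1 * (4 * B * B) * (G k J ^+ 2 / (B * W J + nodesum b k J))).
  apply: ler_sum_ch => // J PJ _; apply: (le_trans (IH _ PJ)).
  have := cross_term_le (F J) (G k J) (a I) h (w I) t0 (m_gt0 PJ) (W_gt0 PJ).
  rewrite -/(a J) -/(V J).
  set Z := G k J ^+ 2 / (B * W J + _); move: (F J * G k J / m J) => X.
  move: (G k J ^+ 2 / W J) => Y.
  rewrite -subr_ge0 => le0; rewrite -subr_ge0.
  apply: (le_trans le0); rewrite le_eqVlt; apply/orP; left; apply/eqP; ring.
have bI : 0 <= b I by rewrite mulr_ge0 ?sqr_ge0// subr_ge0 V_subadditive.
have T0 : 0 <= \sum_(J <- ch I) nodesum b k J.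
  rewrite big_seq; apply: sumr_ge0 => J JI; apply: nodesum_ge0; exact: P_ch JI.
have BWT J : P J -> 0 < B * W J + nodesum b k J.
  by move=> PJ; rewrite ltr_wpDr ?nodesum_ge0// mulr_gt0// W_gt0.
have YE : B * W I + \sum_(J <- ch I) nodesum b k J
    = \sum_(J <- ch I) (B * W J + nodesum b k J).
  by rewrite big_split /= -mulr_sumr -W_add.
set Z := \sum_(J <- ch I) (G k J ^+ 2 / (B * W J + nodesum b k J)).
have cstep : h ^+ 2 * b I - 4 * B * (B * Z) <=
    - (4 * B * (B * (g0 ^+ 2 /
        (B * W I + (b I + \sum_(J <- ch I) nodesum b k J))))).
  apply: carleson_step => //; first exact: (carl k.+1).
  rewrite YE GE; apply: sum_sqr_div => //; first by move=> J PJ _; exact: BWT.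
  by rewrite -YE ltr_wpDr// mulr_gt0.
rewrite [leLHS]HE; apply: (le_trans sumH).
rewrite sumrB !big_split /= -!mulr_sumr !big_split /= -!mulr_sumr.
rewrite !sumrB -!mulr_sumr sumrN -mulr_sumr.
rewrite -(W_add PI) -(m_add PI) -(F_add PI) -GE -HE -/(s I) -/Z.
set Y := g0 ^+ 2 / (B * W I + _) in cstep *.
have bE : \sum_(J <- ch I) V J = (b I + W I) / w I ^+ 2.
  rewrite /b /V /w; field.
  by rewrite !gt_eqF.
rewrite bE -subr_ge0.
(* After summation everything cancels except the slack of [cstep], divided by [t]. *)
rewrite (_ : _ - _ =
  t^-1 * (- (4 * B * (B * Y)) - (h ^+ 2 * b I - 4 * B * (B * Z)))).
  by rewrite mulr_ge0 ?subr_ge0// invr_ge0 ltW.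
rewrite /h /w /a; field.
by rewrite !gt_eqF.
Qed.

(** Mean zero kills the pairing at the root, and [t = 2 + 8 * B] makes [(1 + 4 * B) / t] equal to
    1/2, so that half of [H k I] is absorbed on the left. *)
Lemma square_function_lower_bound k I : P I -> F I = 0 -> 0 < Qi ->
  H k I <= (2 + 16 * (Q * Qi)) * nodesum s k I.
Proof.
move=> PI FI Qi0; have WI := W_gt0 PI.
have Q0 : 0 < Q by rewrite (lt_le_trans ltr01)// (node_const_ge1 PI).
set B := 2 * Q * Qi.
have B0 : 0 < B by rewrite !mulr_gt0.
have t0 : 0 < 2 + 8 * B by rewrite addr_gt0// mulr_gt0.
have := square_function_potential k t0 B0 nodesum_carleson PI.
rewrite FI !mul0r add0r.
set Y := G k I ^+ 2 / W I; set Z := G k I ^+ 2 / _; set t := 2 + 8 * B.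
have Y0 : 0 <= Y by rewrite divr_ge0 ?sqr_ge0// ltW.
have Z0 : 0 <= Z.
  apply/divr_ge0/addr_ge0/nodesum_ge0 => //; first exact: sqr_ge0.
  by rewrite mulr_ge0 ?(ltW B0) ?(ltW WI).
have e : t^-1 * (H k I - Y + 4 * B * (H k I - B * Z))
    <= H k I / 2.
  rewrite -(ler_pM2l t0) mulrA mulfV ?gt_eqF// mul1r -/t /t.
  rewrite -subr_ge0 (_ : _ - _ = Y + 4 * (B * (B * Z))); last by field.
  by rewrite addr_ge0// mulr_ge0// mulr_ge0 ?(ltW B0)// mulr_ge0// (ltW B0).
by rewrite (_ : 2 + 16 * (Q * Qi) = t); [move: e; lra | rewrite /t /B; ring].
Qed.
End FiniteTree.

Local Open Scope ereal_scope.

(** * Atoms and conditional expectations *)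

Section Atoms.
Context {d : measure_display} {T : measurableType d} {R : realType}.
Variables (nu : probability T R) (D : nat -> set (set T)).
Hypothesis HD : atomic_filtration nu D.

Lemma atom0 : D 0%N = [set setT]. Proof. by case: HD. Qed.

Lemma finite_atoms n : finite_set (D n).
Proof. by case: HD => _ [+ _]; apply. Qed.

Lemma measurable_atom {n I} : D n I -> measurable I.
Proof. by case: HD => _ [_ [+ _]] => /(_ n I) + DI => /(_ DI)[]. Qed.

Lemma measure_atom_gt0 {n I} : D n I -> 0 < nu I.
Proof. by case: HD => _ [_ [+ _]] => /(_ n I) + DI => /(_ DI)[]. Qed.

Lemma atoms_cover n : \bigcup_(I in D n) I = setT.
Proof. by case: HD => _ [_ [_ [+ _]]]; apply. Qed.

Lemma atom_inj {n I J x} : D n I -> D n J -> I x -> J x -> I = J.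
Proof.
move=> DI DJ Ix Jx; apply: contrapT => IJ.
case: HD => _ [_ [_ [_ [+ _]]]] => /(_ n I J DI DJ IJ) e.
by have : (I `&` J) x by []; rewrite e.
Qed.

Lemma atom_parent {n J} : D n.+1 J -> exists2 I, D n I & J `<=` I.
Proof.
case: HD => _ [_ [_ [_ [_ [+ _]]]]] => /(_ n J) + DJ => /(_ DJ)[I []].
by exists I.
Qed.

Lemma atom_sub {n I J x} : D n I -> D n.+1 J -> I x -> J x -> J `<=` I.
Proof.
move=> DI DJ Ix Jx; have [K DK JK] := atom_parent DJ.
by rewrite (atom_inj DI DK Ix (JK _ Jx)).
Qed.

(** The default [setT] is never taken, since the atoms of each generation cover the space. *)
Definition cell n x : set T := xget setT [set I | D n I /\ I x].

Lemma cellP n x : D n (cell n x) /\ cell n x x.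
Proof.
rewrite /cell; case: xgetP => [I -> //|/(_ _)/= H].
have : (\bigcup_(I in D n) I) x by rewrite atoms_cover.
by move=> [I DI Ix]; case: (H I).
Qed.

Lemma cell_atom n x : D n (cell n x). Proof. by case: (cellP n x). Qed.

Lemma cell_in n x : cell n x x. Proof. by case: (cellP n x). Qed.

Lemma cell_eq {n I x} : D n I -> I x -> cell n x = I.
Proof. by move=> DI; exact: (atom_inj (cell_atom n x) DI (cell_in n x)). Qed.

Lemma cell_sub n k x : cell (n + k) x `<=` cell n x.
Proof.
elim: k => [|k IH]; first by rewrite addn0.
rewrite addnS; apply: subset_trans IH.
exact: (atom_sub (cell_atom _ x) (cell_atom _ x) (cell_in _ x) (cell_in _ x)).
Qed.

Definition children n (I : set T) : seq (set T) :=
  enum_fset (fset_set [set J | D n.+1 J /\ J `<=` I]).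

Lemma mem_children n I J : (J \in children n I) <-> D n.+1 J /\ J `<=` I.
Proof.
rewrite -[X in X <-> _]/(is_true (J \in fset_set _)).
rewrite in_fset_set ?in_setE//.
by apply: (sub_finite_set _ (finite_atoms n.+1)) => K [].
Qed.

Lemma uniq_children n I : uniq (children n I).
Proof. exact: fset_uniq. Qed.

Lemma cover_children n I : D n I -> \big[setU/set0]_(J <- children n I) J = I.
Proof.
move=> DI; rewrite -bigcup_seq; apply/seteqP; split => x.
  by move=> [J /= /mem_children[_ JI] /JI].
move=> Ix; exists (cell n.+1 x); last exact: cell_in.
apply/mem_children; split; first exact: cell_atom.
exact: (atom_sub DI (cell_atom _ x) Ix (cell_in _ x)).
Qed.

Lemma integral_disjoint_union (s : seq (set T)) (g : T -> \bar R) :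
  (forall J, J \in s -> measurable J) -> uniq s ->
  (forall J K x, J \in s -> K \in s -> J x -> K x -> J = K) ->
  measurable_fun setT g ->
  \int[nu]_(x in \big[setU/set0]_(J <- s) J) g x =
  \sum_(J <- s) \int[nu]_(x in J) g x.
Proof.
move=> + + + mg; elim: s => [|I s IH] ms us ds.
  by rewrite !big_nil integral_set0.
have mI : measurable I by apply: ms; rewrite mem_head.
have ms' J : J \in s -> measurable J by move=> Js; apply: ms; rewrite inE Js orbT.
have mU : measurable (\big[setU/set0]_(J <- s) J).
  by rewrite big_seq; apply: bigsetU_measurable => J /ms'.
rewrite !big_cons integral_setU//.
- rewrite IH//; first by case/andP: us.
  by move=> J K x Js Ks; apply: ds; rewrite inE (Js, Ks) orbT.
- exact: measurable_funTS.
- rewrite disj_set2E; apply/eqP/seteqP; split=> // x [Ix].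
  rewrite -bigcup_seq => -[J /= Js Jx].
  have e : I = J by apply: (ds _ _ x) => //; rewrite inE (eqxx, Js) ?orbT.
  by case/andP: us; rewrite e Js.
Qed.

Lemma integral_children n I (g : T -> \bar R) : D n I ->
  measurable_fun setT g ->
  \int[nu]_(x in I) g x = \sum_(J <- children n I) \int[nu]_(x in J) g x.
Proof.
move=> DI mg; rewrite -{1}(cover_children DI) integral_disjoint_union//.
- by move=> J /mem_children[/measurable_atom].
- exact: uniq_children.
- by move=> J K x /mem_children[DJ _] /mem_children[DK _]; exact: (atom_inj DJ DK).
Qed.

Lemma integral_atoms n (g : T -> \bar R) : measurable_fun setT g ->
  \int[nu]_x g x = \sum_(J <- enum_fset (fset_set (D n))) \int[nu]_(x in J) g x.
Proof.
move=> mg; have D_in J : J \in enum_fset (fset_set (D n)) -> D n J.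
  rewrite -[X in X -> _]/(is_true (J \in fset_set _)).
  by rewrite in_fset_set ?in_setE//; exact: finite_atoms.
rewrite -(atoms_cover n) -bigsetU_fset_set; last exact: finite_atoms.
rewrite integral_disjoint_union//.
- by move=> J /D_in/measurable_atom.
- exact: fset_uniq.
- by move=> J K x /D_in DJ /D_in DK; exact: (atom_inj DJ DK).
Qed.

Lemma measurable_cell {d'} {U : measurableType d'} n (phi : set T -> U) :
  measurable_fun setT (fun x => phi (cell n x)).
Proof.
move=> _ Y mY; rewrite setTI.
rewrite (_ : _ @^-1` _ = \bigcup_(I in [set I | D n I /\ Y (phi I)]) I).
  apply: fin_bigcup_measurable; last by move=> I [/measurable_atom].
  by apply: (sub_finite_set _ (finite_atoms n)) => I [].
apply/seteqP; split=> x /=.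
  by move=> Yx; exists (cell n x); [split => //; exact: cell_atom|exact: cell_in].
by move=> [I [DI YI] Ix]; rewrite (cell_eq DI Ix).
Qed.

(* Nodes carry their generation, as a set may be an atom of several of them. *)
Definition subatoms (p : nat * set T) : seq (nat * set T) :=
  [seq (p.1.+1, J) | J <- children p.1 p.2].

Definition is_atom (p : nat * set T) : Prop := D p.1 p.2.

Lemma is_atom_subatoms p q : is_atom p -> q \in subatoms p -> is_atom q.
Proof. by move=> _ /mapP[J /mem_children[DJ _] ->]. Qed.

Definition massf (g : T -> R) (p : nat * set T) : R :=
  fine (\int[nu]_(x in p.2) (g x)%:E).

Definition massm (p : nat * set T) : R := fine (nu p.2).

Lemma massfE (g : T -> R) p : nu.-integrable setT (EFin \o g) -> is_atom p ->
  (massf g p)%:E = \int[nu]_(x in p.2) (g x)%:E.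
Proof.
move=> ig /measurable_atom mp; rewrite fineK//.
by apply: integrable_fin_num => //; apply: integrableS ig.
Qed.

Lemma massf_additive (g : T -> R) : nu.-integrable setT (EFin \o g) ->
  tree_additive subatoms is_atom (massf g).
Proof.
move=> ig p Dp; apply: EFin_inj; rewrite massfE// big_map -sumEFin.
rewrite (integral_children Dp); last exact: measurable_int ig.
apply: eq_big_seq => J /mem_children[DJ _].
by rewrite massfE.
Qed.

Lemma massmE p : is_atom p -> (massm p)%:E = nu p.2.
Proof. by move=> Dp; rewrite fineK// fin_num_measure//; exact: measurable_atom Dp. Qed.

Lemma massm_gt0 p : is_atom p -> (0 < massm p)%R.
Proof. by move=> Dp; rewrite -lte_fin massmE// (measure_atom_gt0 Dp). Qed.

Lemma massf1 p : is_atom p -> massf (cst 1%R) p = massm p.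
Proof.
move=> Dp; congr fine; rewrite -[RHS]mul1e -(@integral_cst _ _ _ nu p.2)//.
exact: measurable_atom Dp.
Qed.

Lemma massm_additive : tree_additive subatoms is_atom massm.
Proof.
move=> p Dp; rewrite -massf1// massf_additive//; last first.
  exact: finite_measure_integrable_cst.
by apply: eq_big_seq => q qp; rewrite massf1//; exact: is_atom_subatoms qp.
Qed.

(** A zero integral would force [g] to vanish almost everywhere on an atom, which has positive
    measure. *)
Lemma massf_gt0 (g : T -> R) p : nu.-integrable setT (EFin \o g) ->
  (forall x, 0 < g x)%R -> is_atom p -> (0 < massf g p)%R.
Proof.
move=> ig g0 Dp; have mp := measurable_atom Dp.
have mg : measurable_fun p.2 (EFin \o g).
  by apply: measurable_funTS; exact: measurable_int ig.
rewrite -lte_fin massfE// lt0e; apply/andP; split; last first.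
  by apply: integral_ge0 => x _; rewrite lee_fin ltW.
apply/negP => /eqP e.
have /ae_eq_integral_abs : \int[nu]_(x in p.2) `|(EFin \o g) x| = 0.
  by rewrite -[RHS]e; apply: eq_integral => x _; rewrite /= ger0_norm// ltW.
move=> /(_ mp mg)[N [mN N0 sN]].
have : nu p.2 <= nu N.
  apply: le_measure => [||x px]; [exact: mem_set|exact: mem_set|].
  by apply: sN => /= /(_ px)[] /eqP; rewrite gt_eqF// normr_gt0 gt_eqF.
by rewrite N0 leNgt (measure_atom_gt0 Dp).
Qed.

Lemma avgE (g : T -> R) n I : nu.-integrable setT (EFin \o g) -> D n I ->
  avg nu I g = (massf g (n, I) / massm (n, I))%R.
Proof. by move=> ig DI; rewrite /avg /eavg -(massfE ig (p := (n, I)))// mulrC. Qed.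

Lemma eavgE (g : T -> R) n I : nu.-integrable setT (EFin \o g) -> D n I ->
  eavg nu I (EFin \o g) = (massf g (n, I) / massm (n, I))%:E.
Proof. by move=> ig DI; rewrite /eavg -(massfE ig (p := (n, I)))// mulrC. Qed.

End Atoms.

(** * Integrals over atoms as tree sums *)

Section WeightedTree.
Context {d : measure_display} {T : measurableType d} {R : realType}.
Variables (nu : probability T R) (D : nat -> set (set T)).
Hypothesis HD : atomic_filtration nu D.
Variable w : T -> R.
Hypothesis iw : nu.-integrable setT (EFin \o w).
Hypothesis w_gt0 : forall x, (0 < w x)%R.

Let mw : measurable_fun setT w.
Proof. by apply/measurable_EFinP; exact: measurable_int iw. Qed.

Let W := massf nu w.
Let m := massm nu.
Let ch := subatoms D.

Lemma integral_cst_weight n I (c : R) : D n I -> (0 <= c)%R ->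
  \int[nu]_(x in I) (c * w x)%:E = (c * W (n, I))%:E.
Proof.
move=> DI c0; under eq_integral do rewrite EFinM.
rewrite ge0_integralZl_EFin//; last 3 first.
- exact: (measurable_atom HD DI).
- by move=> x _; rewrite lee_fin ltW.
- by apply: measurable_funTS; apply/measurable_EFinP.
by rewrite -(massfE HD iw (p := (n, I))).
Qed.

(** With [phi] the squared average of f, this identifies the weighted square integral of a
    conditional expectation with the [H] of the finite tree. *)
Lemma integral_leafsum (phi : nat * set T -> R) k n I :
  (forall p, 0 <= phi p)%R -> D n I ->
  \int[nu]_(x in I) (phi ((n + k)%N, cell D (n + k) x) * w x)%:E =
  (leafsum ch (fun p => phi p * W p)%R k (n, I))%:E.
Proof.
move=> phi0; elim: k n I => [|k IH] n I DI /=.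
  rewrite addn0 -integral_cst_weight//; apply: eq_integral => x /set_mem Ix.
  by rewrite (cell_eq HD DI Ix).
rewrite (integral_children HD DI); last first.
  apply/measurable_EFinP; apply: measurable_funM => //.
  exact: (measurable_cell HD (n + k.+1)%N (fun J => phi (_, J))).
rewrite big_map -sumEFin; apply: eq_big_seq => J /(mem_children HD)[DJ _].
by rewrite -addSnnS IH.
Qed.

Definition condexp (g : T -> R) n x := avg nu (cell D n x) g.

Lemma measurable_condexp g n : measurable_fun setT (condexp g n).
Proof. exact: (measurable_cell HD n (fun J => avg nu J g)). Qed.

Lemma condexpE g n I x : nu.-integrable setT (EFin \o g) -> D n I -> I x ->
  condexp g n x = (massf nu g (n, I) / m (n, I))%R.
Proof. by move=> ig DI Ix; rewrite /condexp (cell_eq HD DI Ix) (avgE HD ig DI). Qed.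

Definition sqdiff g n x := ((condexp g n.+1 x - condexp g n x) ^+ 2)%R.

Lemma measurable_sqdiff g n : measurable_fun setT (sqdiff g n).
Proof.
by apply: measurable_funX; apply: measurable_funB; exact: measurable_condexp.
Qed.

Lemma integral_nodesum g k n I : nu.-integrable setT (EFin \o g) -> D n I ->
  \int[nu]_(x in I) ((\sum_(i < k) sqdiff g (n + i) x) * w x)%:E =
  (nodesum ch (fun p => \sum_(q <- ch p)
    (massf nu g q / m q - massf nu g p / m p) ^+ 2 * W q)%R k (n, I))%:E.
Proof.
move=> ig; elim: k n I => [|k IH] n I DI /=.
  by under eq_integral do rewrite big_ord0 mul0r; rewrite integral0.
have mq : measurable_fun setT (fun x => (sqdiff g n x * w x)%:E).
  by apply/measurable_EFinP; apply: measurable_funM => //; exact: measurable_sqdiff.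
have ms l : measurable_fun setT
    (fun x => ((\sum_(i < k) sqdiff g (l + i) x) * w x)%:E).
  apply/measurable_EFinP; apply: measurable_funM => //.
  by apply: measurable_sum => i; exact: measurable_sqdiff.
transitivity (\int[nu]_(x in I) ((sqdiff g n x * w x)%:E +
    ((\sum_(i < k) sqdiff g (n.+1 + i) x) * w x)%:E)).
  apply: eq_integral => x _; rewrite big_ord_recl addn0 mulrDl EFinD.
  by under eq_bigr do rewrite lift0 -addSnnS.
rewrite ge0_integralD//; last 5 first.
- exact: (measurable_atom HD DI).
- by move=> x _; rewrite lee_fin mulr_ge0 ?sqr_ge0// ltW.
- exact: measurable_funTS.
- move=> x _; rewrite lee_fin mulr_ge0 ?(ltW (w_gt0 x))//.
  by apply: sumr_ge0 => i _; exact: sqr_ge0.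
- exact: measurable_funTS.
rewrite !(integral_children HD DI)// EFinD !big_map -!sumEFin.
congr (_ + _); apply: eq_big_seq => J /(mem_children HD)[DJ JI]; last exact: IH.
rewrite -integral_cst_weight ?sqr_ge0//; apply: eq_integral => x /set_mem Jx.
by rewrite /sqdiff (condexpE ig DJ Jx) (condexpE ig DI (JI x Jx)).
Qed.

(** The pointwise counterpart of [maxsum]: generation [n] enters only through [l], and generations
    [n + 1] to [n + k] are added. *)
Fixpoint runmax k n (l : R) x : R :=
  if k is k'.+1 then runmax k' n.+1 (Num.max l (condexp w n.+1 x)) x else l.

Lemma measurable_runmax k n (l : T -> R) : measurable_fun setT l ->
  measurable_fun setT (fun x => runmax k n (l x) x).
Proof.
elim: k n l => [//|k IH] n l ml /=; apply: (IH n.+1).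
by apply: measurable_maxr => //; exact: measurable_condexp.
Qed.

Lemma integral_runmax k n I l : (0 <= l)%R -> D n I ->
  \int[nu]_(x in I) (runmax k n l x)%:E =
  (maxsum ch m (fun p => W p / m p)%R k l (n, I))%:E.
Proof.
elim: k n I l => [|k IH] n I l l0 DI /=.
  have mI := measurable_atom HD DI.
  by rewrite (@integral_cst _ _ _ nu I)// EFinM (massmE HD (p := (n, I))).
rewrite (integral_children HD DI); last first.
  apply/measurable_EFinP/(measurable_runmax k n.+1) => //.
  by apply: measurable_maxr => //; exact: measurable_condexp.
rewrite big_map -sumEFin; apply: eq_big_seq => J /(mem_children HD)[DJ JI].
rewrite -IH ?le_max ?l0//; apply: eq_integral => x /set_mem Jx.
by rewrite (condexpE iw DJ Jx).
Qed.

Lemma runmax_ge k n l x : (l <= runmax k n l x)%R.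
Proof.
elim: k n l => [//|k IH] n l /=; apply: le_trans (IH _ _).
by rewrite le_max lexx.
Qed.

Lemma runmax_ge_condexp k n l x i : (i < k)%N ->
  (condexp w (n.+1 + i) x <= runmax k n l x)%R.
Proof.
elim: k n l i => [//|k IH] n l [_|i] /=.
  by rewrite addn0; apply: le_trans (runmax_ge _ _ _ _); rewrite le_max lexx orbT.
by rewrite ltnS -addSnnS => /IH.
Qed.

Lemma runmax_le k n l x y : (l <= y)%R ->
  (forall i, (i < k)%N -> condexp w (n.+1 + i) x <= y)%R ->
  (runmax k n l x <= y)%R.
Proof.
elim: k n l => [//|k IH] n l ly wy /=; apply: IH.
  by rewrite ge_max ly -[n.+1]addn0 wy.
by move=> i ik; rewrite addSnnS wy.
Qed.

Lemma runmax_nondecreasing n l x : nondecreasing_seq (fun k => runmax k n l x).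
Proof.
move=> i j ij; apply: runmax_le; first exact: runmax_ge.
by move=> a ai; apply: runmax_ge_condexp; exact: leq_trans ai ij.
Qed.

Lemma massf_w_gt0 p : is_atom D p -> (0 < W p)%R.
Proof. exact: massf_gt0. Qed.

(** An atom containing [x] is the cell of [x] in its generation, so the supremum over atoms is one
    over generations; the initial value accounts for generation [n], and positivity removes the
    absolute value. *)
Lemma Mloc_runmax n I x : D n I -> I x ->
  Mloc nu D n I w x =
  ereal_sup (range (fun k => (runmax k n (W (n, I) / m (n, I)) x)%:E)).
Proof.
move=> DI Ix; rewrite /Mloc indicE mem_set// mul1e.
have eE j J : D j J -> J x -> `|eavg nu J (EFin \o w)| = (condexp w j x)%:E.
  move=> DJ Jx; rewrite (eavgE HD iw DJ) (condexpE iw DJ Jx) gee0_abs//.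
  by rewrite lee_fin ltW// divr_gt0 ?massf_w_gt0 ?(massm_gt0 HD).
have wn : condexp w n x = (W (n, I) / m (n, I))%R by rewrite (condexpE iw DI Ix).
apply/eqP; rewrite eq_le; apply/andP; split.
  apply: ge_ereal_sup => _ [j [J [[nj DJ JI Jx] ->]]].
  rewrite (eE j J)//; move: nj; rewrite leq_eqVlt => /predU1P[<-|nj].
    by apply: ereal_sup_ubound; exists 0%N; rewrite //= wn.
  apply: (@le_trans _ _ (runmax (j - n) n (W (n, I) / m (n, I)) x)%:E).
    rewrite lee_fin -[in leLHS](subnKC nj) runmax_ge_condexp//.
    by rewrite subnS prednK// subn_gt0.
  by apply: ereal_sup_ubound; exists (j - n)%N.
apply: ge_ereal_sup => _ [k _ <-].
have sub j : (n <= j)%N -> (condexp w j x)%:E <=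
  ereal_sup [set r | exists i J, [/\ (n <= i)%N, D i J, J `<=` I & J x] /\
     r = `|eavg nu J (EFin \o w)|].
  move=> nj; apply: ereal_sup_ubound; exists j, (cell D j x).
  have cj := cell_atom HD j x; have xj := cell_in HD j x.
  split; last by rewrite (eE j).
  split => //; rewrite -(cell_eq HD DI Ix) -(subnKC nj).
  exact: (cell_sub HD).
set M := ereal_sup _ in sub *.
case: M sub => [y| |] sub; last 2 first.
- by rewrite leey.
- by have := sub n (leqnn n).
rewrite lee_fin; apply: runmax_le => [|i ik]; rewrite -lee_fin.
  by rewrite -wn sub.
by rewrite sub// leqW// leq_addr.
Qed.

(** Monotone convergence in the depth reduces the maximal function to finite trees. *)
Lemma integral_Mloc n I : D n I ->
  \int[nu]_(x in I) Mloc nu D n I w x = ereal_sup (range (fun k =>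
    (maxsum ch m (fun p => W p / m p)%R k (W (n, I) / m (n, I)) (n, I))%:E)).
Proof.
move=> DI; set l := (W (n, I) / m (n, I))%R.
have l0 : (0 <= l)%R by rewrite ltW// divr_gt0 ?massf_w_gt0 ?(massm_gt0 HD).
have nd x : nondecreasing_seq (fun k => (runmax k n l x)%:E).
  by move=> i j ij; rewrite lee_fin runmax_nondecreasing.
transitivity (\int[nu]_(x in I) limn (fun k => (runmax k n l x)%:E)).
  apply: eq_integral => x /set_mem Ix; rewrite Mloc_runmax//.
  by apply/esym/cvg_lim => //; exact: ereal_nondecreasing_cvgn.
have mI := measurable_atom HD DI.
rewrite monotone_convergence//; last 2 first.
- by move=> k; apply/measurable_EFinP/measurable_funTS/measurable_runmax.
- by move=> k x _; rewrite lee_fin; exact: le_trans (runmax_ge _ _ _ _).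
rewrite (_ : (fun k => _) = (fun k =>
    (maxsum ch m (fun p => W p / m p)%R k l (n, I))%:E)); last first.
  by apply/funext => k; rewrite integral_runmax.
apply/cvg_lim => //; apply: ereal_nondecreasing_cvgn => i j ij.
rewrite -!integral_runmax//; apply: ge0_le_integral => //.
- by move=> x _; rewrite lee_fin; exact: le_trans (runmax_ge _ _ _ _).
- by apply/measurable_EFinP/measurable_funTS/measurable_runmax.
- by apply/measurable_EFinP/measurable_funTS/measurable_runmax.
- by move=> x _; exact: nd.
Qed.

End WeightedTree.

(** * Density of step functions *)

Section Density.
Import HBSimple.
Context {d : measure_display} {T : measurableType d} {R : realType}.
Variables (nu : probability T R) (D : nat -> set (set T)).
Hypothesis HD : atomic_filtration nu D.

(** Measurability with respect to the [n]-th generation, expressed as constancy on its atoms. *)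
Definition is_step n (h : T -> R) : Prop :=
  forall x y, cell D n x = cell D n y -> h x = h y.

Lemma measurable_is_step n h : is_step n h -> measurable_fun setT h.
Proof.
move=> sh _ Y mY; rewrite setTI.
rewrite (_ : _ @^-1` _ =
    \bigcup_(I in [set I | D n I /\ exists2 x, I x & Y (h x)]) I).
  apply: fin_bigcup_measurable; last by move=> I [/(measurable_atom HD)].
  by apply: (sub_finite_set _ (finite_atoms HD n)) => I [].
apply/seteqP; split=> x /=.
  move=> Yx; exists (cell D n x); last exact: (cell_in HD).
  by split; [exact: (cell_atom HD)|exists x => //; exact: (cell_in HD)].
move=> [I [DI [y Iy Yy]] Ix].
by rewrite (sh x y)// (cell_eq HD DI Ix) (cell_eq HD DI Iy).
Qed.

Lemma is_stepS n m h : (n <= m)%N -> is_step n h -> is_step m h.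
Proof.
move=> nm sh x y xy; apply: sh; apply: (cell_eq HD (cell_atom HD n y)).
have := @cell_sub _ _ _ _ _ HD n (m - n) y; rewrite subnKC// -xy; apply.
exact: (cell_in HD).
Qed.

Definition step_approximable (g : T -> R) : Prop := measurable_fun setT g /\
  forall e : R, (0 < e)%R -> exists n h, is_step n h /\
    \int[nu]_x (`|g x - h x|)%:E <= e%:E.

Lemma is_step_approximable n h : is_step n h -> step_approximable h.
Proof.
move=> sh; split; first exact: measurable_is_step sh.
move=> e e0; exists n, h; split=> //.
by under eq_integral do rewrite subrr normr0; rewrite integral0 lee_fin ltW.
Qed.

Let mdist (g h : T -> R) : measurable_fun setT g -> measurable_fun setT h ->
  measurable_fun setT (fun x => (`|g x - h x|)%:E).
Proof.
move=> mg mh; apply/measurable_EFinP; apply: measurableT_comp => //.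
exact: measurable_funB.
Qed.

(** A Lipschitz operation applied to two step functions is a step function of the finer generation,
    and the errors add up; sums, multiples and maxima are instances. *)
Lemma step_approximable_lipschitz (o : R -> R -> R) (C : R) (g1 g2 : T -> R) :
  (0 < C)%R ->
  (forall a b a' b', `|o a b - o a' b'| <= C * `|a - a'| + C * `|b - b'|)%R ->
  measurable_fun setT (fun x => o (g1 x) (g2 x)) ->
  step_approximable g1 -> step_approximable g2 ->
  step_approximable (fun x => o (g1 x) (g2 x)).
Proof.
move=> C0 lip mo [mg1 ag1] [mg2 ag2]; split=> // e e0.
have e' : (0 < e / (2 * C))%R by rewrite divr_gt0// mulr_gt0.
have [n1 [h1 [s1 le1]]] := ag1 _ e'; have [n2 [h2 [s2 le2]]] := ag2 _ e'.
have sh : is_step (maxn n1 n2) (fun x => o (h1 x) (h2 x)).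
  move=> x y xy; rewrite (is_stepS (leq_maxl n1 n2) s1 xy).
  by rewrite (is_stepS (leq_maxr n1 n2) s2 xy).
exists (maxn n1 n2), (fun x => o (h1 x) (h2 x)); split=> //.
have mh1 := measurable_is_step s1; have mh2 := measurable_is_step s2.
apply: (@le_trans _ _ (\int[nu]_x (C%:E * (`|g1 x - h1 x|)%:E +
    C%:E * (`|g2 x - h2 x|)%:E))).
  apply: ge0_le_integral => //.
  - by apply: mdist => //; exact: measurable_is_step sh.
  - by apply: emeasurable_funD; apply: measurable_funeM; exact: mdist.
  - by move=> x _; rewrite -!EFinM -EFinD lee_fin.
rewrite ge0_integralD//; last 4 first.
- by move=> x _; rewrite -EFinM lee_fin mulr_ge0// ltW.
- by apply: measurable_funeM; exact: mdist.
- by move=> x _; rewrite -EFinM lee_fin mulr_ge0// ltW.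
- by apply: measurable_funeM; exact: mdist.
rewrite !ge0_integralZl_EFin ?(ltW C0)//; [|exact: mdist..].
have Cle x : x <= (e / (2 * C))%:E -> C%:E * x <= (e / 2)%:E.
  move=> xe; apply: (@le_trans _ _ (C%:E * (e / (2 * C))%:E)).
    by rewrite lee_pmul2l.
  by rewrite -EFinM lee_fin le_eqVlt; apply/orP; left; apply/eqP; field; rewrite gt_eqF.
by rewrite [e]splitr EFinD leeD// Cle.
Qed.

Lemma step_approximable_closed (g : T -> R) : measurable_fun setT g ->
  (forall e : R, (0 < e)%R -> exists2 g', step_approximable g' &
    \int[nu]_x (`|g x - g' x|)%:E <= e%:E) -> step_approximable g.
Proof.
move=> mg cg; split=> // e e0; have e2 : (0 < e / 2)%R by rewrite divr_gt0.
have [g' [mg' ag'] gg'] := cg _ e2; have [n [h [sh g'h]]] := ag' _ e2.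
exists n, h; split=> //; have mh := measurable_is_step sh.
apply: (@le_trans _ _ (\int[nu]_x ((`|g x - g' x|)%:E + (`|g' x - h x|)%:E))).
  apply: ge0_le_integral => //; [exact: mdist|by apply: emeasurable_funD; exact: mdist|].
  by move=> x _; rewrite -EFinD lee_fin ler_distD.
rewrite ge0_integralD//; [|exact: mdist..].
by rewrite [e]splitr EFinD leeD.
Qed.

Lemma step_approximable_cst (c : R) : step_approximable (cst c).
Proof. exact: (@is_step_approximable 0%N). Qed.

Lemma step_approximableD g1 g2 : step_approximable g1 -> step_approximable g2 ->
  step_approximable (fun x => g1 x + g2 x)%R.
Proof.
move=> a1 a2; apply: (@step_approximable_lipschitz (fun a b => a + b)%R 1%R) => //.
  by move=> a b a' b'; rewrite !mul1r opprD addrACA ler_normD.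
by apply: measurable_funD; [case: a1|case: a2].
Qed.

Lemma step_approximableZ (c : R) g : step_approximable g ->
  step_approximable (fun x => c * g x)%R.
Proof.
(* The 1 in [|c| + 1] keeps the Lipschitz constant positive when [c = 0]. *)
move=> ag; apply: (@step_approximable_lipschitz (fun a b => c * b)%R (`|c| + 1)%R
    (cst 0%R) g) => //.
- move=> a b a' b'; rewrite -mulrBr normrM ler_wpDl ?mulr_ge0//.
  by rewrite ler_wpM2r// lerDl.
- by apply: measurable_funM => //; case: ag.
- exact: step_approximable_cst.
Qed.

Lemma step_approximable_max g1 g2 : step_approximable g1 -> step_approximable g2 ->
  step_approximable (fun x => Num.max (g1 x) (g2 x)).
Proof.
move=> a1 a2; apply: (@step_approximable_lipschitz Num.max 1%R) => //.
  move=> a b a' b'; rewrite !mul1r.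
  have := ler_norm (a - a'); have := ler_norm (a' - a).
  have := ler_norm (b - b'); have := ler_norm (b' - b).
  rewrite (distrC a' a) (distrC b' b) ler_norml.
  by case: (leP a b) => ?; case: (leP a' b') => ?; move=> *; apply/andP; split; lra.
by apply: measurable_maxr; [case: a1|case: a2].
Qed.

Let approximable_sets : set (set T) :=
  [set A | measurable A /\ step_approximable (\1_A : T -> R)].

Lemma approximable_bigsetU (A : nat -> set T) n :
  (forall i, approximable_sets (A i)) ->
  approximable_sets (\big[setU/set0]_(i < n) A i).
Proof.
move=> aA; elim: n => [|n [mU aU]].
  rewrite big_ord0; split=> //.
  by rewrite (_ : \1_set0 = cst 0%R :> (T -> R)) ?indic0//; exact: step_approximable_cst.
have [mA aAn] := aA n; rewrite big_ord_recr /=; split; first exact: measurableU.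
rewrite (_ : \1_(_ `|` _) = (fun x => Num.max
    (\1_(\big[setU/set0]_(i < n) A i) x) (\1_(A n) x)) :> (T -> R)).
  exact: step_approximable_max.
apply/funext => x; rewrite !indicE in_setU.
by case: (x \in _); case: (x \in _); rewrite /= ?maxxx ?(max_l ler01) ?(max_r ler01).
Qed.

(** Complements use [1 - \1_A], finite unions use maxima of indicators, and countable unions follow
    by continuity of the finite measure from below. *)
Lemma sigma_algebra_approximable_sets : sigma_algebra setT approximable_sets.
Proof.
split.
- split=> //; rewrite (_ : \1_set0 = cst 0%R :> (T -> R)) ?indic0//.
  exact: step_approximable_cst.
- move=> A [mA aA]; split; first exact: measurableD.
  rewrite (_ : \1_(_ `\` _) = (fun x => cst 1 x + -1 * \1_A x)%R :> (T -> R)).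
    apply: step_approximableD; first exact: step_approximable_cst.
    exact: step_approximableZ.
  apply/funext => x; rewrite !indicE in_setD in_setT /=.
  by case: (x \in A); rewrite /= mulN1r ?subrr ?subr0.
move=> A aA; have mA i : measurable (A i) by case: (aA i).
have mU : measurable (\bigcup_i A i) by exact: bigcup_measurable.
split=> //; apply: step_approximable_closed => [|e e0].
  exact: measurable_indic.
pose U n := \big[setU/set0]_(i < n) A i.
have mUn n : measurable (U n) by apply: bigsetU_measurable.
have Usub n : U n `<=` \bigcup_i A i.
  by rewrite /U -bigcup_mkord; apply: bigcup_sub => k _; exact: bigcup_sup.
have cvU : nu \o U @ \oo --> nu (\bigcup_i A i).
  have e1 : \bigcup_i A i = \bigcup_n U n.
    apply/seteqP; split=> x.
      move=> [i _ Aix]; exists i.+1 => //; rewrite /U -bigcup_mkord.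
      by exists i => //=.
    by move=> [n _ /Usub].
  rewrite e1; apply: nondecreasing_cvg_mu => //; first by rewrite -e1.
  move=> i j ij; apply/subsetPset; rewrite /U -!bigcup_mkord.
  by apply: bigcup_sub => k /= ki; apply: bigcup_sup => /=; exact: leq_trans ki ij.
have finU : nu (\bigcup_i A i) \is a fin_num by exact: fin_num_measure.
have [n nUn] : exists n, nu (\bigcup_i A i) - e%:E < nu (U n).
  apply: contrapT => /forallNP nU.
  have : limn (nu \o U) <= nu (\bigcup_i A i) - e%:E.
    apply: lime_le; first by apply/cvg_ex; eexists; exact: cvU.
    by apply: nearW => n /=; rewrite leNgt; apply/negP.
  by rewrite (cvg_lim _ cvU)// leNgt lteBlDr// lteDl// lte_fin e0.
exists (\1_(U n)); first by case: (approximable_bigsetU n aA).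
rewrite (_ : (fun x => _) = (fun x => (\1_(\bigcup_i A i `\` U n) x)%:E)); last first.
  apply/funext => x; rewrite !indicE in_setD; congr (_%:E).
  have := Usub n x; case: (boolP (x \in U n)) => [/set_mem Ux /(_ Ux) Ax|_ _] /=.
    by rewrite (mem_set Ax) subrr normr0.
  by rewrite subr0 andbT ger0_norm.
rewrite integral_indic//; last exact: measurableD.
rewrite setIT measureD//; last by rewrite -ge0_fin_numE// fin_num_measure.
rewrite (_ : _ `&` _ = U n); last by apply/setIidPr.
by rewrite leeBlDr ?fin_num_measure// addeC -leeBlDr// ltW.
Qed.

(** The approximable sets form a sigma-algebra containing the atoms, and the atoms generate all
    measurable sets. *)
Lemma step_approximable_indic A : measurable A -> step_approximable (\1_A : T -> R).
Proof.
case: HD => _ [_ [_ [_ [_ [_ ->]]]]] sA.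
have sub : [set A | exists n, D n A] `<=` approximable_sets.
  move=> J [n DJ]; split; first exact: (measurable_atom HD DJ).
  apply: (@is_step_approximable n) => x y xy; rewrite !indicE; congr (nat_of_bool _)%:R.
  apply/idP/idP => /set_mem Jx; apply/mem_set.
    by rewrite -(cell_eq HD DJ Jx) xy; exact: (cell_in HD).
  by rewrite -(cell_eq HD DJ Jx) -xy; exact: (cell_in HD).
by case: (smallest_sub sigma_algebra_approximable_sets sub sA).
Qed.

Lemma step_approximable_sfun (g : {sfun T >-> R}) :
  step_approximable (fun x => g x).
Proof.
rewrite (_ : (fun x => g x) = (fun x => \sum_(y <- enum_fset (fset_set (range g)))
    y * \1_(g @^-1` [set y]) x)%R); last first.
  by apply/funext => x; rewrite fimfunE fsbig_finite.
elim: (enum_fset _) => [|y s IH].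
  under eq_fun do rewrite big_nil; exact: step_approximable_cst.
under eq_fun do rewrite big_cons.
apply: step_approximableD => //; apply: step_approximableZ.
exact: step_approximable_indic.
Qed.

Lemma step_approximable_integrable (g : T -> R) :
  nu.-integrable setT (EFin \o g) -> step_approximable g.
Proof.
move=> ig; apply: step_approximable_closed => [|e e0].
  by apply/measurable_EFinP; exact: measurable_int ig.
have [g_ [_ _ cg]] := approximation_sfun_integrable measurableT ig.
have [n gn] : exists n, \int[nu]_z (`|g z - g_ n z|)%:E < e%:E.
  apply: contrapT => /forallNP nU.
  have : e%:E <= limn (fun n => \int[nu]_(z in setT) `|(EFin \o g) z - (g_ n z)%:E|).
    apply: lime_ge; first by apply/cvg_ex; eexists; exact: cg.
    by apply: nearW => n /=; rewrite leNgt; apply/negP.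
  by rewrite (cvg_lim _ cg)// lee_fin leNgt e0.
by exists (g_ n); [exact: step_approximable_sfun|exact: ltW].
Qed.

(* On an atom where [h = c], compare [g] with [c] and [c] with the mean of [g]. *)
Lemma integral_dist_condexp (g : T -> R) n h :
  nu.-integrable setT (EFin \o g) -> is_step n h ->
  \int[nu]_x (`|g x - condexp nu D g n x|)%:E
    <= 2%:E * \int[nu]_x (`|g x - h x|)%:E.
Proof.
move=> ig sh; have mh := measurable_is_step sh.
have mg : measurable_fun setT g by apply/measurable_EFinP; exact: measurable_int ig.
have mE := measurable_condexp HD g n.
rewrite !(integral_atoms HD n); [|exact: mdist..].
rewrite ge0_sume_distrr; last first.
  by move=> J _; apply: integral_ge0 => x _; rewrite lee_fin.
rewrite big_seq [leRHS]big_seq; apply: lee_sum => I.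
rewrite -[X in X -> _]/(is_true (I \in fset_set _)).
rewrite in_fset_set ?in_setE; last exact: (finite_atoms HD).
move=> DI; have mI := measurable_atom HD DI.
have nuI := measure_atom_gt0 HD DI.
have [x0 Ix0] : I !=set0.
  by apply/set0P/eqP => I0; move: nuI; rewrite I0 measure0 ltxx.
set c := h x0; have hc x : I x -> h x = c.
  by move=> Ix; apply: sh; rewrite (cell_eq HD DI Ix) (cell_eq HD DI Ix0).
set a := (massf nu g (n, I) / massm nu (n, I))%R.
have m0 : (0 < massm nu (n, I))%R by exact: (massm_gt0 HD).
have igI : nu.-integrable I (EFin \o g) by exact: integrableS ig.
have icI : nu.-integrable I (EFin \o cst c) by exact: finite_measure_integrable_cst.
have mgI : measurable_fun I g by exact: measurable_funTS.
have mcI : measurable_fun I (fun x => (`|g x - c|)%:E).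
  by apply/measurable_EFinP/measurableT_comp => //; exact: measurable_funB.
have ca : (`|c - a| * massm nu (n, I))%:E <= \int[nu]_(x in I) (`|g x - c|)%:E.
  rewrite -{1}[massm nu _](gtr0_norm m0) -normrM mulrBl divfK ?gt_eqF//.
  rewrite distrC -abse_EFin EFinB EFinM.
  rewrite (massfE HD ig (p := (n, I)))// (massmE HD (p := (n, I)))//=.
  rewrite -(@integral_cst _ _ _ nu I)// -integralB_EFin//.
  by apply: le_abse_integral => //; apply/measurable_EFinP/measurable_funB.
apply: (@le_trans _ _ (\int[nu]_(x in I) ((`|g x - c|)%:E + (`|c - a|)%:E))).
  apply: ge0_le_integral => //.
  - by apply: measurable_funTS; exact: mdist.
  - exact: emeasurable_funD.
  - move=> x Ix; rewrite -EFinD lee_fin (condexpE HD ig DI Ix).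
    exact: ler_distD.
rewrite ge0_integralD// (@integral_cst _ _ _ nu I)//.
rewrite EFinM (massmE HD (p := (n, I)))// in ca.
rewrite (_ : 2%:E = 1 + 1)//.
rewrite ge0_muleDl// mul1e; apply: leeD; last first.
  apply: (le_trans ca); rewrite le_eqVlt; apply/orP; left; apply/eqP.
  by apply: eq_integral => x /set_mem Ix; rewrite hc.
rewrite le_eqVlt; apply/orP; left; apply/eqP.
by apply: eq_integral => x /set_mem Ix; rewrite hc.
Qed.

(** One generation for each [e] is enough, because it is paired with a bound that is uniform in
    [n]. *)
Lemma condexp_cvg_L1 (g : T -> R) (e : R) :
  nu.-integrable setT (EFin \o g) -> (0 < e)%R ->
  exists n, \int[nu]_x (`|g x - condexp nu D g n x|)%:E <= e%:E.
Proof.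
move=> ig e0; have e2 : (0 < e / 2)%R by rewrite divr_gt0.
have [mg /(_ _ e2)[n [h [sh gh]]]] := step_approximable_integrable ig.
exists n; apply: (le_trans (integral_dist_condexp ig sh)).
rewrite (_ : e%:E = 2%:E * (e / 2)%:E); first by rewrite lee_pmul2l.
by rewrite -EFinM mulrC divfK.
Qed.

End Density.

(** * Passage to the limit in the generation *)

Section Convergence.
Context {d : measure_display} {T : measurableType d} {R : realType}.
Variables (nu : probability T R) (D : nat -> set (set T)).
Hypothesis HD : atomic_filtration nu D.
Variables w f : T -> R.
Hypothesis mw : measurable_fun setT w.
Hypothesis w_gt0 : forall x, (0 < w x)%R.
Hypothesis if_ : nu.-integrable setT (EFin \o f).

Let mf : measurable_fun setT f.
Proof. by apply/measurable_EFinP; exact: measurable_int if_. Qed.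

(** Truncating both factors makes the integrand Lipschitz in [f] with a constant free of [w], so
    that unweighted closeness in L^1 controls it. *)
Let trunc (M : R) (x : T) : R :=
  (Num.min `|f x| M ^+ 2 * Num.min (w x) M)%R.

Let trunc_ge0 (M : R) x : (0 <= M)%R -> (0 <= trunc M x)%R.
Proof. by move=> M0; rewrite mulr_ge0 ?sqr_ge0// le_min (ltW (w_gt0 x)). Qed.

Let measurable_trunc M : measurable_fun setT (fun x => (trunc M x)%:E).
Proof.
apply/measurable_EFinP/measurable_funM; last exact: measurable_minr.
by apply/measurable_funX/measurable_minr => //; exact: measurableT_comp.
Qed.

(** With [p], [q] the truncations of [|a|], [|b|], the difference of squares is [(p - q) * (p + q)],
    where [p - q <= |a - b|] and [(p + q) * u <= 2 * M * M]. *)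
Lemma trunc_square_le (M a b v : R) : (0 <= M)%R -> (0 <= v)%R ->
  (Num.min `|a| M ^+ 2 * Num.min v M <= b ^+ 2 * v + 2 * M ^+ 2 * `|a - b|)%R.
Proof.
move=> M0 v0; set p : R := Num.min `|a|%R M.
set q : R := Num.min `|b|%R M; set u : R := Num.min v M.
have u0 : (0 <= u)%R by rewrite le_min v0.
have uM : (u <= M)%R by rewrite ge_min lexx orbT.
have uv : (u <= v)%R by rewrite ge_min lexx.
have p0 : (0 <= p)%R by rewrite le_min normr_ge0.
have q0 : (0 <= q)%R by rewrite le_min normr_ge0.
have pM : (p <= M)%R by rewrite ge_min lexx orbT.
have qM : (q <= M)%R by rewrite ge_min lexx orbT.
have qb : (q ^+ 2 * u <= b ^+ 2 * v)%R.
  apply: ler_pM => //; first exact: sqr_ge0.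
  by rewrite -(real_normK (num_real b)) ler_pXn2r ?nnegrE// ge_min lexx.
have pq : (p - q <= `|a - b|)%R.
  have := ler_dist_dist a b; have := ler_norm (`|a| - `|b|)%R.
  have := normr_ge0 (a - b)%R; rewrite /p /q.
  by case: (leP `|a|%R M) => ?; case: (leP `|b|%R M) => ?; lra.
have : ((p - q) * ((p + q) * u) <= `|a - b| * (2 * M * M))%R.
  apply: (@le_trans _ _ (`|a - b| * ((p + q) * u))%R).
    by apply: ler_wpM2r => //; rewrite mulr_ge0// addr_ge0.
  apply: ler_wpM2l => //; apply: ler_pM => //; first exact: addr_ge0.
  by move: pM qM; lra.
by move: qb; rewrite !expr2; lra.
Qed.

(** For a fixed truncation level the bound passes from a nearby conditional expectation to [f] up to
    any [e]; the level then tends to infinity by monotone convergence. *)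
Lemma integral_sqr_le_condexp (B : R) :
  (forall n, \int[nu]_x ((condexp nu D f n x) ^+ 2 * w x)%:E <= B%:E) ->
  \int[nu]_x (f x ^+ 2 * w x)%:E <= B%:E.
Proof.
move=> condB; have truncB M : (0 <= M)%R -> \int[nu]_x (trunc M x)%:E <= B%:E.
  move=> M0; apply/lee_addgt0Pr => e e0.
  (* The added 1 keeps the divisor positive when [M = 0]. *)
  have c0 : (0 < 2 * M ^+ 2 + 1)%R by rewrite ltr_wpDl// mulr_ge0// sqr_ge0.
  have e1 : (0 < e / (2 * M ^+ 2 + 1))%R by rewrite divr_gt0.
  have [n fn] := condexp_cvg_L1 HD if_ e1.
  have mE := measurable_condexp HD f n.
  have md : measurable_fun setT (fun x => (`|f x - condexp nu D f n x|)%:E).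
    by apply/measurable_EFinP/measurableT_comp => //; exact: measurable_funB.
  have ms : measurable_fun setT (fun x => (condexp nu D f n x ^+ 2 * w x)%:E).
    by apply/measurable_EFinP/measurable_funM => //; exact: measurable_funX.
  apply: (@le_trans _ _ (\int[nu]_x ((condexp nu D f n x ^+ 2 * w x)%:E +
      (2 * M ^+ 2)%:E * (`|f x - condexp nu D f n x|)%:E))).
    apply: ge0_le_integral => //.
    - by move=> x _; rewrite lee_fin trunc_ge0.
    - by apply: emeasurable_funD => //; exact: measurable_funeM.
    - by move=> x _; rewrite -EFinM -EFinD lee_fin trunc_square_le// ltW.
  have M2 : (0 <= 2 * M ^+ 2)%R by rewrite mulr_ge0// sqr_ge0.
  rewrite ge0_integralD//; last 3 first.
  - by move=> x _; rewrite lee_fin mulr_ge0 ?sqr_ge0// ltW.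
  - by move=> x _; rewrite -EFinM lee_fin mulr_ge0.
  - exact: measurable_funeM.
  rewrite leeD// ge0_integralZl_EFin//.
  apply: (@le_trans _ _ ((2 * M ^+ 2)%:E * (e / (2 * M ^+ 2 + 1))%:E)).
    by rewrite lee_wpmul2l// lee_fin.
  rewrite -EFinM lee_fin mulrA ler_pdivrMr// mulrC ler_pM2l//; lra.
have -> : \int[nu]_x (f x ^+ 2 * w x)%:E =
    \int[nu]_x limn (fun n => (trunc n%:R x)%:E).
  apply: eq_integral => x _; apply/esym/cvg_lim => //.
  apply: cvg_near_cst; near=> n.
  have fn : (`|f x| <= n%:R)%R by near: n; exact: nbhs_infty_ger.
  have wn : (w x <= n%:R)%R by near: n; exact: nbhs_infty_ger.
  by rewrite /trunc !min_l// real_normK// num_real.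
have trunc_nd x : nondecreasing_seq (fun n => (trunc n%:R x)%:E).
  move=> i j ij; have ijR : (i%:R <= j%:R :> R)%R by rewrite ler_nat.
  have mle (y : R) : (Num.min y i%:R <= Num.min y j%:R)%R.
    by rewrite le_min !ge_min lexx ijR orbT.
  rewrite lee_fin; apply: ler_pM => //.
    by rewrite le_min (ltW (w_gt0 x)) ler0n.
  by rewrite ler_pXn2r// nnegrE le_min normr_ge0 ler0n.
rewrite monotone_convergence//; last first.
  by move=> n x _; rewrite lee_fin trunc_ge0.
apply: lime_le; last by apply: nearW => n; exact: truncB.
apply: ereal_nondecreasing_is_cvgn => i j ij; apply: ge0_le_integral => //.
- by move=> x _; rewrite lee_fin trunc_ge0.
- by move=> x _; exact: trunc_nd.
Unshelve. all: by end_near. Qed.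
End Convergence.

(** * The weighted inequality *)

Lemma measurable_fun_inv {d : measure_display} {T : measurableType d}
    {R : realType} (w : T -> R) :
  measurable_fun setT w -> measurable_fun setT (fun x => (w x)^-1)%R.
Proof.
(* The power has a nonnegative base and the factor [w x] restores the sign; at [w x = 0] both sides
   are 0. *)
move=> mw; rewrite (_ : (fun x => _) = (fun x => w x * (w x ^+ 2) `^ (-1))%R).
  apply: measurable_funM => //; apply: (measurableT_comp (measurable_powR _)).
  exact: measurable_funX.
apply/funext => x; rewrite powR_inv1 ?sqr_ge0//.
have [->|w0] := eqVneq (w x) 0%R; first by rewrite invr0 mul0r.
by field.
Qed.

Section Characteristics.
Context {d : measure_display} {T : measurableType d} {R : realType}.
Variables (nu : probability T R) (D : nat -> set (set T)).
Hypothesis HD : atomic_filtration nu D.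

Lemma fsum_single {M : nmodType} {I : choiceType} (A : set I) (F : I -> M) a :
  A a -> (forall i, A i -> i <> a -> F i = 0%R) ->
  (\sum_(i \in A) F i)%R = F a.
Proof.
move=> Aa F0; rewrite -(@fsbig_widen _ _ _ _ [set a]) ?fsbig_set1//.
  by move=> i ->.
by move=> i [Ai ia]; exact: F0.
Qed.

Lemma mdiff_in n I (f : T -> R) x : D n I -> I x ->
  mdiff nu D n I f x = (condexp nu D f n.+1 x - condexp nu D f n x)%R.
Proof.
move=> DI Ix; rewrite /mdiff /condE (@fsum_single _ _ _ _ (cell D n.+1 x)).
- by rewrite /condexp (cell_eq HD DI Ix) !indicE !mem_set ?mulr1//; exact: (cell_in HD).
- split; first exact: (cell_atom HD).
  exact: (atom_sub HD DI (cell_atom HD n.+1 x) Ix (cell_in HD n.+1 x)).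
move=> J [DJ _] nJ; rewrite indicE memNset ?mulr0// => Jx; apply: nJ.
by rewrite (cell_eq HD DJ Jx).
Qed.

Lemma mdiff_out n I (f : T -> R) x : D n I -> ~ I x -> mdiff nu D n I f x = 0%R.
Proof.
move=> DI Ix; rewrite /mdiff /condE fsbig1.
  by rewrite indicE memNset// mulr0 subrr.
by move=> J [_ JI]; rewrite indicE memNset ?mulr0// => /JI.
Qed.

(** In each generation only the atom containing [x] has a nonzero difference at [x]. *)
Lemma sqfunE (f : T -> R) x :
  sqfun nu D f x = sqrte (\sum_(n <oo) (sqdiff nu D f n x)%:E).
Proof.
congr sqrte; apply: eq_eseriesr => n _.
rewrite (@fsum_single _ _ _ _ (cell D n x)).
- by rewrite (mdiff_in _ (cell_atom HD n x) (cell_in HD n x)).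
- exact: (cell_atom HD).
move=> I DI nI; rewrite mdiff_out ?expr0n// => Ix; apply: nI.
by rewrite (cell_eq HD DI Ix).
Qed.

Lemma L2w_sqfun (w f : T -> R) :
  L2w nu w (sqfun nu D f) =
  sqrte (\int[nu]_x ((\sum_(n <oo) (sqdiff nu D f n x)%:E) * (w x)%:E)).
Proof.
congr sqrte; apply: eq_integral => x _; congr (_ * _).
have s0 : 0 <= \sum_(n <oo) (sqdiff nu D f n x)%:E.
  by apply: nneseries_ge0 => n _ _; rewrite lee_fin sqr_ge0.
by rewrite sqfunE gee0_abs ?sqrte_ge0// sqr_sqrte.
Qed.

Variable w : T -> R.
Hypothesis iw : nu.-integrable setT (EFin \o w).
Hypothesis w_gt0 : forall x, (0 < w x)%R.
Hypothesis A2_fin : A2 nu D w < +oo.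

Let mw : measurable_fun setT w.
Proof. by apply/measurable_EFinP; exact: measurable_int iw. Qed.

Let v x := ((w x)^-1)%R.

Let v_gt0 x : (0 < v x)%R. Proof. by rewrite invr_gt0. Qed.

Let W := massf nu w.
Let S := massf nu v.
Let m := massm nu.

Let mv : measurable_fun setT v.
Proof. exact: measurable_fun_inv. Qed.

(** Otherwise the term of [A2] at the whole space would be infinite, the mean of [w] being
    positive. *)
Lemma integrable_inv_weight : nu.-integrable setT (EFin \o v).
Proof.
apply/integrableP; split; first exact/measurable_EFinP.
rewrite (_ : \int[nu]_x _ = \int[nu]_x (v x)%:E); last first.
  by apply: eq_integral => x _; rewrite /= ger0_norm// ltW.
have DT : D 0%N setT by rewrite (atom0 HD).
rewrite ltNge leye_eq; apply/negP => /eqP voo.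
move: A2_fin; rewrite ltNge => /negP; apply.
suff <- : eavg nu setT (EFin \o w) * eavg nu setT (fun x => (v x)%:E) = +oo.
  by apply: ereal_sup_ubound; exists 0%N, setT.
rewrite (eavgE HD iw DT) /eavg voo !gt0_muley// lte_fin.
  by apply: divr_gt0; [exact: (massf_gt0 HD)|exact: (massm_gt0 HD)].
by rewrite invr_gt0; exact: (massm_gt0 HD (p := (0%N, setT))).
Qed.

Let iv := integrable_inv_weight.
Let Q := fine (A2 nu D w).

Lemma A2_ubound n I : D n I ->
  (W (n, I) / m (n, I) * (S (n, I) / m (n, I)))%:E <= A2 nu D w.
Proof.
move=> DI; apply: ereal_sup_ubound; exists n, I; split=> //.
by rewrite (eavgE HD iw DI) (eavgE HD iv DI) -EFinM.
Qed.

Lemma A2E : A2 nu D w = Q%:E.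
Proof.
rewrite fineK// fin_real// A2_fin andbT.
have DT : D 0%N setT by rewrite (atom0 HD).
exact: lt_le_trans (ltNyr _) (A2_ubound DT).
Qed.

Lemma A2_mass p : is_atom D p -> (W p * S p <= Q * m p ^+ 2)%R.
Proof.
case: p => n I DI; have mI : (0 < m (n, I))%R by exact: (massm_gt0 HD).
have := A2_ubound DI; rewrite A2E lee_fin.
by rewrite -ler_pdivrMr ?exprn_gt0// mulrACA -invfM -expr2.
Qed.

(** Integrate [2 <= t * w + (t * w)^-1] over the atom with [t = m p / W p]. *)
Lemma massf_CS p : is_atom D p -> (m p ^+ 2 <= W p * S p)%R.
Proof.
move=> Dp; have mp := measurable_atom HD Dp.
have mI : (0 < m p)%R by exact: (massm_gt0 HD).
have WI : (0 < W p)%R by exact: (massf_gt0 HD).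
set t := (m p / W p)%R; have t0 : (0 < t)%R by rewrite divr_gt0.
have ip g : nu.-integrable setT (EFin \o g) -> nu.-integrable p.2 (EFin \o g).
  by move=> ig; apply: integrableS ig.
have iZ (c : R) g : nu.-integrable p.2 (EFin \o g) ->
    nu.-integrable p.2 (EFin \o (fun x => c * g x)%R).
  by move=> ig; exact: (integrableZl mp c ig).
have h : (massf nu (cst 2%R) p <= massf nu (fun x => t * w x + t^-1 * v x)%R p)%R.
  apply: le_Rintegral => //.
  - exact: finite_measure_integrable_cst.
  - by apply: (integrableD mp (iZ t _ (ip _ iw)) (iZ t^-1%R _ (ip _ iv))).
  move=> x _ /=; have wx := w_gt0 x; rewrite -subr_ge0.
  rewrite (_ : _ - _ = (t * w x - 1) ^+ 2 / (t * w x))%R.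
    by rewrite divr_ge0 ?sqr_ge0// ltW// mulr_gt0.
  by rewrite /v; field; rewrite !gt_eqF.
have e1 : massf nu (cst 2%R) p = (2 * m p)%R.
  by rewrite -[LHS]/(\int[nu]_(x in p.2) cst 2 x)%R Rintegral_cst.
have e2 : massf nu (fun x => t * w x + t^-1 * v x)%R p = (t * W p + t^-1 * S p)%R.
  rewrite -[LHS]/(\int[nu]_(x in p.2) (t * w x + t^-1 * v x))%R.
  rewrite RintegralD//; last 2 first.
  - exact: iZ (ip _ iw).
  - exact: iZ (ip _ iv).
  by rewrite !RintegralZl//; exact: ip.
rewrite e1 e2 /t in h; move: h.
rewrite divfK ?gt_eqF// invf_div -subr_ge0.
rewrite (_ : _ - _ = (W p * S p - m p ^+ 2) / m p)%R.
  by rewrite pmulr_lge0 ?invr_gt0// subr_ge0.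
by field; rewrite gt_eqF.
Qed.

Let mx k p := maxsum (subatoms D) m (fun p => W p / m p)%R k (W p / m p)%R p.

Let mx_A2 k p : is_atom D p -> (mx k p <= 2 * Q * W p)%R.
Proof.
exact: (maxsum_w_le_A2 (@is_atom_subatoms _ _ _ _ _ HD) (massm_additive HD)
  (massf_additive HD iw) (massf_additive HD iv) (massm_gt0 HD)
  (fun p => massf_gt0 HD iw w_gt0) (fun p => massf_gt0 HD iv v_gt0)
  massf_CS A2_mass).
Qed.

(** [X] is the integral over [I] of the localized maximal function; its finiteness comes from the
    uniform bound [mx_A2]. *)
Let Ainf_term n I : D n I -> exists2 X : R,
  (forall k, mx k (n, I) <= X)%R /\ (X <= 2 * Q * W (n, I))%R &
  eavg nu I (Mloc nu D n I w) * ((fine (eavg nu I (EFin \o w)))^-1)%:E =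
  (X / W (n, I))%:E.
Proof.
move=> DI; have mI : (0 < m (n, I))%R by exact: (massm_gt0 HD).
have WI : (0 < W (n, I))%R by exact: (massf_gt0 HD).
rewrite (eavgE HD iw DI) /eavg (integral_Mloc HD iw w_gt0 DI).
set X := ereal_sup _.
have Xub : X <= (2 * Q * W (n, I))%:E.
  by apply: ge_ereal_sup => _ [k _ <-]; rewrite lee_fin; exact: mx_A2.
have Xlb k : (mx k (n, I))%:E <= X by apply: ereal_sup_ubound; exists k.
have Xfin : X \is a fin_num.
  by rewrite fin_real// (lt_le_trans (ltNyr _) (Xlb 0%N)) (le_lt_trans Xub (ltry _)).
exists (fine X).
  by split => [k|]; rewrite -lee_fin fineK.
rewrite -{1}(fineK Xfin) -!EFinM /=; congr (_%:E).
transitivity ((m (n, I))^-1 * fine X / (W (n, I) / m (n, I)))%R => //.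
by field; rewrite !gt_eqF.
Qed.

Lemma Ainf_le_A2 : Ainf nu D w <= (2 * Q)%:E.
Proof.
apply: ge_ereal_sup => _ [n [I [DI ->]]].
have [X [_ XQ] ->] := Ainf_term DI.
by rewrite lee_fin ler_pdivrMr//; exact: (massf_gt0 HD).
Qed.

Let Ainf_lb n I k : D n I -> (mx k (n, I) / W (n, I))%:E <= Ainf nu D w.
Proof.
move=> DI; have [X [Xk _] XE] := Ainf_term DI.
apply: (@le_trans _ _ (X / W (n, I))%:E).
  by rewrite lee_fin ler_pM2r// invr_gt0; exact: (massf_gt0 HD).
by rewrite -XE; apply: ereal_sup_ubound; exists n, I.
Qed.

Let Qi := fine (Ainf nu D w).

Lemma AinfE : Ainf nu D w = Qi%:E.
Proof.
rewrite fineK// fin_real// (le_lt_trans Ainf_le_A2 (ltry _)) andbT.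
have DT : D 0%N setT by rewrite (atom0 HD).
exact: lt_le_trans (ltNyr _) (Ainf_lb 0 DT).
Qed.

Lemma maxsum_le_Ainf k p : is_atom D p -> (mx k p <= Qi * W p)%R.
Proof.
case: p => n I DI; rewrite -ler_pdivrMr; last exact: (massf_gt0 HD).
by rewrite -lee_fin -AinfE Ainf_lb.
Qed.

Lemma A2_ge1 : (1 <= Q)%R.
Proof.
have DT : is_atom D (0%N, setT) by rewrite /is_atom (atom0 HD).
have mI : (0 < m (0%N, setT))%R by exact: (massm_gt0 HD).
rewrite -(ler_pM2r (exprn_gt0 2 mI)) mul1r.
exact: le_trans (massf_CS DT) (A2_mass DT).
Qed.

Lemma Ainf_ge1 : (1 <= Qi)%R.
Proof.
have DT : is_atom D (0%N, setT) by rewrite /is_atom (atom0 HD).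
have WI : (0 < W (0%N, setT))%R by exact: (massf_gt0 HD).
have mI : (0 < m (0%N, setT))%R by exact: (massm_gt0 HD).
rewrite -(ler_pM2r WI) mul1r; apply: le_trans (maxsum_le_Ainf 0 DT).
by rewrite /mx /= divfK// gt_eqF.
Qed.

(** Allows [2 + 16 * (Q * Qi)] to be absorbed into [18 * (Q * Qi)]. *)
Lemma A2_Ainf_ge1 : (1 <= Q * Qi)%R.
Proof. by rewrite -[1%R]mulr1 ler_pM// ?A2_ge1 ?Ainf_ge1. Qed.

(** * The two inequalities for a mean-zero function *)

Variable f : T -> R.
Hypothesis mf : measurable_fun setT f.
Hypothesis f_L2w : \int[nu]_x ((f x ^+ 2 * w x)%R)%:E < +oo.
Hypothesis f_mean0 : \int[nu]_x (f x)%:E = 0.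

(** Pointwise [|f| <= f ^+ 2 * w + 1 / w], and both summands are integrable. *)
Lemma integrable_L2w : nu.-integrable setT (EFin \o f).
Proof.
have i2 : nu.-integrable setT (EFin \o (fun x => f x ^+ 2 * w x)%R).
  apply/integrableP; split.
    by apply/measurable_EFinP/measurable_funM => //; exact: measurable_funX.
  rewrite (_ : \int[nu]_x _ = \int[nu]_x (f x ^+ 2 * w x)%:E)//.
  by apply: eq_integral => x _; rewrite /= ger0_norm// mulr_ge0 ?sqr_ge0// ltW.
apply: (le_integrable measurableT _ _ (integrableD measurableT i2 iv)).
  exact/measurable_EFinP.
move=> x _; rewrite /= lee_fin; have wx := w_gt0 x.
rewrite [leRHS]ger0_norm; last first.
  by rewrite addr_ge0 ?(ltW (v_gt0 x))// mulr_ge0 ?sqr_ge0// ltW.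
rewrite -(real_normK (num_real (f x))); set y := `|f x|%R.
rewrite -subr_ge0 (_ : _ - _ = ((y * w x - 2^-1) ^+ 2 + 3 / 4) / w x)%R.
  by rewrite divr_ge0 ?(ltW wx)// addr_ge0 ?sqr_ge0.
by rewrite /v; field; rewrite gt_eqF.
Qed.

Let if_ := integrable_L2w.

(** The finite-tree inequality at the root [setT] with depth [n]; the first [n] squared differences
    are then bounded by the whole series. *)
Lemma integral_condexp_sqr_le n :
  \int[nu]_x ((condexp nu D f n x) ^+ 2 * w x)%:E <=
  (18 * (Q * Qi))%:E *
  \int[nu]_x ((\sum_(n <oo) (sqdiff nu D f n x)%:E) * (w x)%:E).
Proof.
have DT : D 0%N setT by rewrite (atom0 HD).
have c1 := A2_Ainf_ge1.
have s0 i x : 0 <= (sqdiff nu D f i x)%:E by rewrite lee_fin sqr_ge0.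
have msq i : measurable_fun setT (sqdiff nu D f i) by exact: measurable_sqdiff HD _ _.
pose sigma := nodesum (subatoms D) (fun p => \sum_(q <- subatoms D p)
    (massf nu f q / m q - massf nu f p / m p) ^+ 2 * W q)%R n (0%N, setT).
have sigmaE : sigma%:E =
    \int[nu]_x ((\sum_(i < n) sqdiff nu D f i x) * w x)%:E.
  by rewrite -(integral_nodesum HD iw w_gt0 n if_ DT).
apply: (@le_trans _ _ ((18 * (Q * Qi))%:E * sigma%:E)); last first.
  rewrite lee_pmul2l; [|by []|by rewrite lte_fin; lra].
  rewrite sigmaE.
  apply: ge0_le_integral => //.
  - move=> x _; rewrite lee_fin mulr_ge0 ?(ltW (w_gt0 x))//.
    by apply: sumr_ge0 => i _; rewrite sqr_ge0.
  - apply/measurable_EFinP/measurable_funM => //.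
    by apply: measurable_sum => i.
  - apply: emeasurable_funM; last exact/measurable_EFinP.
    by apply: ge0_emeasurable_sum => [i x _ _|i _] //; exact/measurable_EFinP.
  move=> x _; rewrite EFinM lee_wpmul2r ?lee_fin ?(ltW (w_gt0 x))// -sumEFin.
  rewrite -(big_mkord xpredT (fun i => (sqdiff nu D f i x)%:E)).
  exact: nneseries_lim_ge.
have eH := integral_leafsum HD iw w_gt0
  (phi := fun p => ((massf nu f p / m p) ^+ 2)%R) n (fun p => sqr_ge0 _) DT.
rewrite (_ : \int[nu]_x _ = (leafsum (subatoms D)
    (fun p => (massf nu f p / m p) ^+ 2 * W p)%R n (0%N, setT))%:E); last first.
  rewrite -eH; apply: eq_integral => x _.
  by rewrite (condexpE HD if_ (cell_atom HD n x) (cell_in HD n x)).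
rewrite -EFinM lee_fin.
have F0 : massf nu f (0%N, setT) = 0%R by rewrite /massf f_mean0.
have Qi0 : (0 < Qi)%R by exact: lt_le_trans ltr01 Ainf_ge1.
have := @square_function_lower_bound R _ (subatoms D) (is_atom D)
  (@is_atom_subatoms _ _ _ _ _ HD) m W S Q (massm_additive HD)
  (massf_additive HD iw) (massf_additive HD iv) (massm_gt0 HD)
  (fun p => massf_gt0 HD iw w_gt0) massf_CS A2_mass Qi maxsum_le_Ainf
  (massf nu f) (massf_additive HD if_) n (0%N, setT) DT F0 Qi0.
move=> /le_trans; apply.
have : (0 <= sigma)%R.
  rewrite -lee_fin sigmaE; apply: integral_ge0 => x _.
  rewrite lee_fin mulr_ge0 ?(ltW (w_gt0 x))//.
  by apply: sumr_ge0 => i _; rewrite sqr_ge0.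
by move=> sg0; apply: ler_wpM2r => //; lra.
Qed.

Lemma integral_sqr_le_sqfun :
  \int[nu]_x (f x ^+ 2 * w x)%:E <= (18 * (Q * Qi))%:E *
  \int[nu]_x ((\sum_(n <oo) (sqdiff nu D f n x)%:E) * (w x)%:E).
Proof.
have := integral_condexp_sqr_le; set B := _ * _ => condB.
have : 0 <= B by apply: le_trans (condB 0%N); apply: integral_ge0 => x _;
  rewrite lee_fin mulr_ge0 ?sqr_ge0// ltW.
case: B condB => [B condB _|_ _|//]; last exact: leey.
exact: (integral_sqr_le_condexp HD mw w_gt0 if_).
Qed.

Lemma weighted_bound :
  L2w nu w (EFin \o f) <=
    5%:E * sqrte (A2 nu D w) * sqrte (Ainf nu D w) * L2w nu w (sqfun nu D f).
Proof.
rewrite L2w_sqfun; set B := \int[nu]_x _.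
have B0 : 0 <= B.
  apply: integral_ge0 => x _; rewrite mule_ge0 ?lee_fin ?(ltW (w_gt0 x))//.
  by apply: nneseries_ge0 => n _ _; rewrite lee_fin sqr_ge0.
have Q1 := A2_ge1; have Qi1 := Ainf_ge1; have QQ1 := A2_Ainf_ge1.
(* The constant 18 is enlarged to 25, a perfect square. *)
have -> : 5%:E = sqrte (25%:E : \bar R).
  by rewrite /= (_ : 25 = 5 ^+ 2)%R ?sqrtr_sqr ?ger0_norm//; ring.
have A0 : 0 <= A2 nu D w by rewrite A2E lee_fin; lra.
have Ai0 : 0 <= Ainf nu D w by rewrite AinfE lee_fin; lra.
have c0 : 0 <= 25%:E :> \bar R by rewrite lee_fin.
rewrite -!sqrteM ?mule_ge0// /L2w lee_sqrt ?mule_ge0//.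
rewrite (_ : \int[nu]_x _ = \int[nu]_x (f x ^+ 2 * w x)%:E); last first.
  apply: eq_integral => x _ /=; rewrite EFinM; congr (_ * _).
  by rewrite -EFinM -expr2 real_normK ?num_real.
apply: (le_trans integral_sqr_le_sqfun); rewrite lee_wpmul2r//.
by rewrite A2E AinfE -!EFinM lee_fin; nra.
Qed.

(** From [Qi <= 2 * Q <= 4 * Q] one gets [sqrt Qi <= 2 * sqrt Q]. *)
Lemma A2_Ainf_le_A2 :
  5%:E * sqrte (A2 nu D w) * sqrte (Ainf nu D w) * L2w nu w (sqfun nu D f) <=
  (2 * 5)%:E * A2 nu D w * L2w nu w (sqfun nu D f).
Proof.
have Q1 := A2_ge1; have Qi1 := Ainf_ge1.
apply: lee_wpmul2r; first exact: sqrte_ge0.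
have := Ainf_le_A2; rewrite AinfE A2E lee_fin => QiQ.
rewrite -!EFinM lee_fin (mulrC 2%R) -!mulrA ler_pM2l//.
have sQ := sqr_sqrtr (le_trans ler01 Q1).
have : (Num.sqrt Qi <= 2 * Num.sqrt Q)%R.
  rewrite -ler_sqr ?nnegrE ?mulr_ge0 ?sqrtr_ge0// exprMn sQ sqr_sqrtr.
    by rewrite expr2; move: Q1 QiQ; lra.
  exact: le_trans Qi1.
move=> /(ler_wpM2l (sqrtr_ge0 Q))/le_trans; apply.
by rewrite mulrCA -expr2 sQ.
Qed.

End Characteristics.

(** * Reduction to weights that are positive everywhere *)

Section PositiveVersion.
Context {d : measure_display} {T : measurableType d} {R : realType}.
Variables (nu : probability T R) (D : nat -> set (set T)).
Hypothesis HD : atomic_filtration nu D.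
Variable w : T -> R.
Hypothesis iw : nu.-integrable setT (EFin \o w).
Hypothesis w_gt0 : {ae nu, forall x, (0 < w x)%R}.

Let mw : measurable_fun setT w.
Proof. by apply/measurable_EFinP; exact: measurable_int iw. Qed.

(* The weight is positive only almost everywhere; this version keeps every
   integrand pointwise nonnegative. *)
Definition positive_version x : R := if (0 < w x)%R then w x else 1%R.

Local Notation w' := positive_version.

Lemma positive_version_gt0 x : (0 < w' x)%R.
Proof. by rewrite /w'; case: ifP. Qed.

Lemma ae_positive_version : {ae nu, forall x, w x = w' x}.
Proof. by apply: filterS w_gt0 => x wx; rewrite /w' wx. Qed.

Lemma measurable_positive_version : measurable_fun setT w'.
Proof.
apply: measurable_fun_ifT => //.
by apply: measurable_fun_ltr.
Qed.

Let mw' := measurable_positive_version.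

(** The second argument of [g] receives the weight, so one statement covers [w], its inverse and its
    products with a function. *)
Lemma integral_positive_version (g : T -> R -> \bar R) I : measurable I ->
  measurable_fun setT (fun x => g x (w x)) ->
  measurable_fun setT (fun x => g x (w' x)) ->
  \int[nu]_(x in I) g x (w x) = \int[nu]_(x in I) g x (w' x).
Proof.
move=> mI mg mg'; apply: ae_eq_integral => //; try exact: measurable_funTS.
by apply: filterS ae_positive_version => x -> .
Qed.

Lemma integrable_positive_version : nu.-integrable setT (EFin \o w').
Proof.
have /integrableP[_ +] := iw.
rewrite (@integral_positive_version (fun _ y => `|y%:E|)) => // [?||].
- by apply/integrableP; split => //; exact/measurable_EFinP.
- by apply: measurableT_comp => //; exact/measurable_EFinP.
- by apply: measurableT_comp => //; exact/measurable_EFinP.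
Qed.

Lemma eavg_positive_version n I : D n I ->
  eavg nu I (EFin \o w) = eavg nu I (EFin \o w').
Proof.
move=> DI; congr (_ * _).
apply: (@integral_positive_version (fun _ y => y%:E)).
- exact: (measurable_atom HD DI).
- exact/measurable_EFinP.
- exact/measurable_EFinP.
Qed.

Lemma eavg_inv_positive_version n I : D n I ->
  eavg nu I (fun x => ((w x)^-1)%:E) = eavg nu I (fun x => ((w' x)^-1)%:E).
Proof.
move=> DI; congr (_ * _).
apply: (@integral_positive_version (fun _ y => (y^-1)%:E)).
- exact: (measurable_atom HD DI).
- exact/measurable_EFinP/measurable_fun_inv.
- exact/measurable_EFinP/measurable_fun_inv.
Qed.

Lemma A2_positive_version : A2 nu D w = A2 nu D w'.
Proof.
congr ereal_sup; apply/seteqP; split=> _ [n [I [DI ->]]]; exists n, I; split=> //.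
  by rewrite (eavg_positive_version DI) (eavg_inv_positive_version DI).
by rewrite (eavg_positive_version DI) (eavg_inv_positive_version DI).
Qed.

(** The equality holds at every point, since the weight enters only through averages over atoms. *)
Lemma Mloc_positive_version n I : Mloc nu D n I w = Mloc nu D n I w'.
Proof.
apply/funext => x; congr (_ * ereal_sup _); apply/seteqP.
split=> _ [m [J [[nm DJ JI Jx] ->]]]; exists m, J; split=> //.
  by rewrite (eavg_positive_version DJ).
by rewrite (eavg_positive_version DJ).
Qed.

Lemma Ainf_positive_version : Ainf nu D w = Ainf nu D w'.
Proof.
congr ereal_sup; apply/seteqP; split=> _ [n [I [DI ->]]]; exists n, I; split=> //.
  by rewrite (eavg_positive_version DI) Mloc_positive_version.
by rewrite (eavg_positive_version DI) Mloc_positive_version.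
Qed.

Lemma integral_weight_positive_version (g : T -> \bar R) :
  measurable_fun setT g ->
  \int[nu]_x (g x * (w x)%:E) = \int[nu]_x (g x * (w' x)%:E).
Proof.
move=> mg; apply: (@integral_positive_version (fun x y => g x * y%:E)) => //.
  by apply: emeasurable_funM => //; exact/measurable_EFinP.
by apply: emeasurable_funM => //; exact/measurable_EFinP.
Qed.

Lemma L2w_positive_version (f : T -> R) : measurable_fun setT f ->
  L2w nu w (EFin \o f) = L2w nu w' (EFin \o f).
Proof.
move=> mf; congr sqrte.
apply: (@integral_weight_positive_version (fun x => `|(f x)%:E| ^+ 2)).
have me : measurable_fun setT (fun x => `|(f x)%:E|).
  by apply: measurableT_comp => //; exact/measurable_EFinP.
exact: emeasurable_funM.
Qed.

Lemma L2w_sqfun_positive_version (f : T -> R) :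
  L2w nu w (sqfun nu D f) = L2w nu w' (sqfun nu D f).
Proof.
rewrite !(L2w_sqfun HD); congr sqrte; apply: integral_weight_positive_version.
apply: ge0_emeasurable_sum => [n x _ _|n _]; first by rewrite lee_fin sqr_ge0.
by apply/measurable_EFinP; exact: (measurable_sqdiff HD).
Qed.

End PositiveVersion.

Theorem theorem3p1 (R : realType) :
  exists C : R, (0 < C)%R /\
  forall (d : measure_display) (T : measurableType d) (nu : probability T R)
    (D : nat -> set (set T)) (w f : T -> R),
    atomic_filtration nu D ->
    nu.-integrable setT (EFin \o w) ->
    {ae nu, forall x, (0 < w x)%R} ->
    A2 nu D w < +oo ->
    measurable_fun setT f ->
    \int[nu]_x ((f x ^+ 2 * w x)%R)%:E < +oo ->
    \int[nu]_x (f x)%:E = 0 ->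
    L2w nu w (EFin \o f)
      <= C%:E * sqrte (A2 nu D w) * sqrte (Ainf nu D w) * L2w nu w (sqfun nu D f)
    /\
    C%:E * sqrte (A2 nu D w) * sqrte (Ainf nu D w) * L2w nu w (sqfun nu D f)
      <= (2 * C)%:E * A2 nu D w * L2w nu w (sqfun nu D f).
Proof.
exists 5%R; split=> // d T nu D w f HD iw w0 A2w mf f_L2w f_mean0.
have iw' := integrable_positive_version iw w0.
have w'_gt0 := positive_version_gt0 w.
(* Both norms and both characteristics keep their values when [w] is replaced by its positive
   version. *)
rewrite (L2w_positive_version iw w0 mf) (L2w_sqfun_positive_version HD iw w0).
rewrite (A2_positive_version HD iw w0) in A2w *.
rewrite (Ainf_positive_version HD iw w0).
split; last exact: (A2_Ainf_le_A2 HD iw' w'_gt0 A2w).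
apply: (weighted_bound HD iw' w'_gt0 A2w mf _ f_mean0).
under eq_integral do rewrite EFinM.
rewrite -(integral_weight_positive_version iw w0 (g := fun x => (f x ^+ 2)%:E)).
  by under eq_integral do rewrite -EFinM.
by apply/measurable_EFinP; exact: measurable_funX.
Qed.
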